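(* Let $\mathbf{c}=(c_1,\dots,c_m)$ be a vector of positive integers with sum $c=\sum_i c_i$, let $p$ be the number of indices $i$ with $c_i$ odd, and let $g\ge 0$ be an integer. If $\mathrm{Ter}^g_{\mathbf{c}}$ is nonempty, then for any algebraically closed field $k$, \[ (c-m-g)\left(g+m-\frac{c}{2}-\frac{p}{2}\right)\ \le\ \dim\left(\mathrm{Ter}^g_{\mathbf{c}}\times\operatorname{Spec}k\right)\ \le\ (c-m-g)\,g . \]
   Context: For a vector $\mathbf{c}=(c_1,\dots,c_m)$ of positive integers let $A^+_{\mathbf{c}}=\mathbb{Z}[t_1,\dots,t_m]/(t_i^{c_i},\ t_it_j : i\neq j)$, a free $\mathbb{Z}$-module of rank $c-m+1$. The territory $\mathrm{Ter}^g_{\mathbf{c}}$ is the $\mathbb{Z}$-scheme representing the functor sending a scheme $S$ to the set of quasi-coherent $\mathcal{O}_S$-subalgebras $\mathscr{B}\subseteq A^+_{\mathbf{c}}\otimes\mathcal{O}_S$ such that $(A^+_{\mathbf{c}}\otimes\mathcal{O}_S)/\mathscr{B}$ is locally free of rank $g$; it is a closed subscheme of the Grassmannian of rank $c-m+1-g$ subbundles of $A^+_{\mathbf{c}}$. *)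

(* Defs.v *)
From HB Require Import structures.
From mathcomp Require Import all_boot all_order all_algebra.
From mathcomp Require Import ring_quotient mpoly.
From mathcomp Require Import boolp.

Set Implicit Arguments.
Unset Strict Implicit.
Unset Printing Implicit Defensive.

Import GRing.Theory.
Local Open Scope ring_scope.
Local Open Scope quotient_scope.

Section AplusIdeal.
Variables (m : nat) (c : 'I_m -> nat) (c_gt0 : forall i, (0 < c i)%N).
Variable R : comNzRingType.

(* Membership in the ideal (t_i ^ c_i, t_i t_j : i <> j) of R[t_1, .., t_m]. *)
Definition in_Aplus_ideal (f : {mpoly R[m]}) : Prop :=
  exists (u : 'I_m -> {mpoly R[m]}) (v : 'I_m -> 'I_m -> {mpoly R[m]}),
    f = \sum_i u i * 'X_i ^+ c i
        + \sum_i \sum_(j | i != j) v i j * ('X_i * 'X_j).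

(* The proof of positivity is an argument because MathComp ideals are proper. *)
Definition Aplus_ideal of (forall i, (0 < c i)%N) : {pred {mpoly R[m]}} :=
  [pred f | `[< in_Aplus_ideal f >]].

Lemma Aplus_idealP f : reflect (in_Aplus_ideal f) (f \in Aplus_ideal c_gt0).
Proof. exact: asboolP. Qed.

Lemma Aplus_ideal_closed : idealr_closed (Aplus_ideal c_gt0).
Proof.
split.
- apply/Aplus_idealP; exists (fun=> 0), (fun _ _ => 0).
  by rewrite !big1 ?addr0 // => i _; rewrite ?mul0r // big1 // => j _; rewrite mul0r.
- apply/negP => /Aplus_idealP [u [v /(congr1 (fun f => f.@[fun=> 0]))]].
  rewrite mevalD !raddf_sum /= meval1 !big1 ?addr0.
  + by move/eqP; rewrite oner_eq0.
  + by move=> i _; rewrite raddf_sum big1 // => j _; rewrite /= !mevalM !mevalXU mul0r mulr0.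
  + by move=> i _; rewrite mevalM rmorphXn /= mevalXU expr0n eqn0Ngt c_gt0 mulr0.
- move=> a x y /Aplus_idealP [u [v ->]] /Aplus_idealP [u' [v' ->]].
  apply/Aplus_idealP; exists (fun i => a * u i + u' i).
  exists (fun i j => a * v i j + v' i j).
  rewrite mulrDr addrACA !mulr_sumr; congr (_ + _).
    by rewrite -big_split /=; apply: eq_bigr => i _; rewrite mulrDl mulrA.
  rewrite -big_split /=; apply: eq_bigr => i _.
  rewrite mulr_sumr -big_split /=; apply: eq_bigr => j _.
  by rewrite mulrDl -mulrA.
Qed.

HB.instance Definition _ :=
  isIdealr.Build {mpoly R[m]} (Aplus_ideal c_gt0) Aplus_ideal_closed.

(* A^+_c (x) R, as the quotient R[t_1, .., t_m] / (t_i ^ c_i, t_i t_j : i <> j). *)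
Definition Aplus : comNzRingType := {ideal_quot (Aplus_ideal c_gt0)}.

Definition Aplus_cst (a : R) : Aplus := \pi_Aplus (mpolyC m a).

End AplusIdeal.

Section BaseChange.
Variables (m : nat) (c : 'I_m -> nat) (c_gt0 : forall i, (0 < c i)%N).
Variables (R S : comNzRingType) (phi : {rmorphism R -> S}).

Definition Aplus_map (x : Aplus c_gt0 R) : Aplus c_gt0 S :=
  \pi_(Aplus c_gt0 S) (map_mpoly phi (repr x)).

Lemma Aplus_map_pi (f : {mpoly R[m]}) :
  Aplus_map (\pi_(Aplus c_gt0 R) f) = \pi_(Aplus c_gt0 S) (map_mpoly phi f).
Proof.
rewrite /Aplus_map; apply/eqP; rewrite -Quotient.idealrBE -rmorphB /=.
have /Aplus_idealP [u [v ->]] : repr (\pi_(Aplus c_gt0 R) f) - f \in Aplus_ideal c_gt0.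
  by rewrite Quotient.idealrBE reprK.
apply/Aplus_idealP; exists (fun i => map_mpoly phi (u i)).
exists (fun i j => map_mpoly phi (v i j)).
rewrite rmorphD !rmorph_sum /=; congr (_ + _); apply: eq_bigr => i _.
  by rewrite rmorphM rmorphXn /= map_mpolyX.
rewrite rmorph_sum; apply: eq_bigr => j _ /=.
by rewrite !rmorphM /= !map_mpolyX.
Qed.

(* The S-linear span of the image of B. When (A^+_c (x) R) / B is locally free
   this is B (x) S, seen inside A^+_c (x) S. *)
Definition Aplus_base_change (B : pred (Aplus c_gt0 R)) : pred (Aplus c_gt0 S) :=
  [pred y | `[< exists n (s : 'I_n -> S) (x : 'I_n -> Aplus c_gt0 R),
      (forall i, x i \in B) /\
      y = \sum_i Aplus_cst c_gt0 (s i) * Aplus_map (x i) >]].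

End BaseChange.

Section Territory.
Variables (m : nat) (c : 'I_m -> nat) (c_gt0 : forall i, (0 < c i)%N).
Variables (g : nat) (R : comNzRingType).
Local Notation A := (Aplus c_gt0 R).

Definition is_subalgebra (B : pred A) : Prop :=
  subring_closed B /\ forall a : R, Aplus_cst c_gt0 a \in B.

(* (A / B)_f is a free R_f-module of rank g. Multiplying a basis by a power of
   f makes it the image of a family v in A; the two clauses say that v spans
   and is linearly independent after inverting f. *)
Definition quotient_free_away (B : pred A) (f : R) : Prop :=
  exists v : 'I_g -> A,
    (forall x : A, exists N (a : 'I_g -> R),
       Aplus_cst c_gt0 (f ^+ N) * x
         - \sum_i Aplus_cst c_gt0 (a i) * v i \in B) /\
    (forall a : 'I_g -> R,
       \sum_i Aplus_cst c_gt0 (a i) * v i \in B ->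
       exists N, forall i, f ^+ N * a i = 0).

(* A / B is locally free of rank g on Spec R: it is free of rank g over the
   members of a covering by principal open sets D(f_i). *)
Definition quotient_locally_free (B : pred A) : Prop :=
  exists n (f h : 'I_n -> R),
    \sum_i h i * f i = 1 /\ forall i, quotient_free_away B (f i).

(* The Spec R-valued points of Ter^g_c. A scheme is determined by its functor of
   points on affine schemes, so these, with Aplus_base_change as pullback,
   describe Ter^g_c completely. *)
Definition Ter (B : pred A) : Prop :=
  is_subalgebra B /\ quotient_locally_free B.

End Territory.

(* A functor of points on k-algebras, presented as a subfunctor
   R |-> {x : fp_ambient X R | fp_mem x} of an ambient functor. *)
Record functor_of_points (k : fieldType) := FunctorOfPoints {
  fp_ambient : comAlgType k -> Type;
  fp_map : forall R S : comAlgType k,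
    {lrmorphism R -> S} -> fp_ambient R -> fp_ambient S;
  fp_mem : forall R : comAlgType k, fp_ambient R -> Prop
}.

Section Dimension.
Variables (k : fieldType) (X : functor_of_points k).

(* Every ring T below is nonzero; for T = 0 the conditions hold trivially. *)
Definition generates_unit_ideal (S T : comNzRingType) (rho : S -> T)
    (E : S -> Prop) : Prop :=
  exists n (e : 'I_n -> S) (h : 'I_n -> T),
    (forall i, E (e i)) /\ \sum_i h i * rho (e i) = 1.

(* The morphism Spec R -> X given by the point u in X(R) (Yoneda) is an open
   immersion: it is a monomorphism, and for every x : Spec S -> X the fibre
   product of u and x is the open subscheme of Spec S that is the complement
   of V(E), for some subset E of S. *)
Definition affine_open (R : comAlgType k) (u : fp_ambient X R) : Prop :=
  [/\ fp_mem u,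
      forall (T : comAlgType k) (phi psi : {lrmorphism R -> T}),
        fp_map phi u = fp_map psi u -> phi =1 psi
    & forall (S : comAlgType k) (x : fp_ambient X S), fp_mem x ->
        exists E : S -> Prop,
        forall (T : comAlgType k) (rho : {lrmorphism S -> T}),
          (exists phi : {lrmorphism R -> T}, fp_map phi u = fp_map rho x)
          <-> generates_unit_ideal rho E].

Definition prime_chain (R : comNzRingType) (d : nat) (P : nat -> {pred R}) :
    Prop :=
  (forall i, (i <= d)%N -> idealr_closed (P i) /\ prime_idealr_closed (P i)) /\
  (forall i, (i < d)%N -> {subset P i <= P i.+1} /\
                          exists2 x, x \in P i.+1 & x \notin P i).

(* The dimension of a scheme is the supremum of the Krull dimensions of its
   affine open subschemes. *)
Definition has_dim (d : nat) : Prop :=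
  (exists (R : comAlgType k) (u : fp_ambient X R) (P : nat -> {pred R}),
     affine_open u /\ prime_chain d P) /\
  (forall (R : comAlgType k) (u : fp_ambient X R) (e : nat)
          (P : nat -> {pred R}),
     affine_open u -> prime_chain e P -> (e <= d)%N).

End Dimension.

Section TerritoryScheme.
Variables (m : nat) (c : 'I_m -> nat) (c_gt0 : forall i, (0 < c i)%N) (g : nat).

(* A scheme is nonempty iff it has a point with values in some nonzero ring. *)
Definition Ter_nonempty : Prop :=
  exists (R : comNzRingType) (B : pred (Aplus c_gt0 R)), Ter g B.

(* Ter^g_c x Spec k, through its points with values in k-algebras. *)
Definition Ter_over (k : fieldType) : functor_of_points k :=
  @FunctorOfPoints k
    (fun R => pred (Aplus c_gt0 R))
    (fun R S phi => @Aplus_base_change m c c_gt0 R S phi)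
    (fun R => @Ter m c c_gt0 g R).

End TerritoryScheme.

(* Main.v *)
Require Import Defs.
From HB Require Import structures.
From mathcomp Require Import all_boot all_order all_algebra.
From mathcomp Require Import generic_quotient ring_quotient mpoly boolp ring.

(** A subalgebra B of A with A / B free of rank g is, locally, the kernel of a
    matrix x that is the identity on g basis vectors t_J; the remaining rows of
    x, one for each of the c - m - g basis vectors other than 1 outside J, are
    coordinates on the chart "t_J is a basis of A / B".

    Upper bound. Localize an affine open subscheme Spec R at the top P of a
    chain of primes. The pullback of the universal subalgebra lies in a chart,
    and since Spec R is open, every element of R becomes, in R_P and up to a
    power of one unit, a polynomial in the (c - m - g) g coordinates. So the
    chain pulls back to a chain of primes of a polynomial ring in that many
    variables, whose length is bounded by counting monomials.

    Lower bound. The t_i ^ j with 2 j >= c_i span a subspace W of dimension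
    (c - p) / 2 in which all products vanish, so every subspace of W of
    dimension c - m - g gives a point of the territory. If t_J contains the
    complement of W, then the coordinates in W form an affine space of dimension
    (c - m - g) (dim W - (c - m - g)) in the chart. *)

Set Implicit Arguments.
Unset Strict Implicit.
Unset Printing Implicit Defensive.

Import Order.TTheory GRing.Theory Num.Theory.
Local Open Scope ring_scope.
Local Open Scope quotient_scope.

(** * Quotients, subalgebras and localizations of algebras *)

(** An affine open subscheme is known only through the functor of points, so nothing says that its
    ring R is finitely generated. Three facts make up for this. Over a local ring some g monomials
    form a basis of A / B, because one minor is a unit. The subalgebra is then already defined over
    the k-algebra generated by its coordinates. Openness and the monomorphism property finally map R
    into that algebra with one element inverted. Transcendence degree is avoided as well: elements
    that separate successive primes satisfy no algebraic relation over k.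

    Charts are built without writing down their equations: the ideal is defined through its points,
    and chains of primes are kernels of morphisms to a polynomial ring.

    With w = dim W and r = c - m - g, the relation 2 w + p = c turns the second factor of the lower
    bound into w - r, the number of frame monomials in W when the other r are chosen in W. If w < r,
    the bound is negative and only a point over k is needed: the span of 1 and of r monomials closed
    under multiples. *)

Definition alg_of_morphism (k : fieldType) (Q : comNzRingType)
  of {rmorphism k -> Q} : Type := Q.

Section AlgebraOfMorphism.
Variables (k : fieldType) (Q : comNzRingType) (iota : {rmorphism k -> Q}).
Local Notation A := (alg_of_morphism iota).

HB.instance Definition _ := GRing.ComNzRing.on A.

Let scale (a : k) (x : A) : A := iota a * x.

Fact alg_of_morphism_scaleA a b v : scale a (scale b v) = scale (a * b) v.
Proof. by rewrite /scale mulrA rmorphM. Qed.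
Fact alg_of_morphism_scale1 : left_id 1 scale.
Proof. by move=> v; rewrite /scale rmorph1 mul1r. Qed.
Fact alg_of_morphism_scaleDr : right_distributive scale +%R.
Proof. by move=> a u v; rewrite /scale mulrDr. Qed.
Fact alg_of_morphism_scaleDl v : {morph scale^~ v : a b / a + b}.
Proof. by move=> a b; rewrite /scale rmorphD mulrDl. Qed.

HB.instance Definition _ := GRing.Zmodule_isLmodule.Build k A
  alg_of_morphism_scaleA alg_of_morphism_scale1
  alg_of_morphism_scaleDr alg_of_morphism_scaleDl.

Fact alg_of_morphism_scaleAl (a : k) (u v : A) : a *: (u * v) = (a *: u) * v.
Proof. exact: mulrA. Qed.

HB.instance Definition _ :=
  GRing.Lmodule_isLalgebra.Build k A alg_of_morphism_scaleAl.
HB.instance Definition _ := GRing.Lalgebra_isComAlgebra.Build k A.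

Lemma alg_of_morphismE (a : k) (x : A) : a *: x = iota a * x.
Proof. by []. Qed.
End AlgebraOfMorphism.

Lemma lrmorphismP (k : fieldType) (S T : comAlgType k) (f : S -> T) :
  zmod_morphism f -> monoid_morphism f -> scalable f ->
  exists g : {lrmorphism S -> T}, g =1 f.
Proof.
move=> fB fM fZ.
pose a := GRing.isZmodMorphism.Build S T f fB.
pose b := GRing.isMonoidMorphism.Build S T f fM.
pose d := GRing.isScalable.Build k S T *:%R f fZ.
pose h : {lrmorphism S -> T} := HB.pack f a b d.
by exists h.
Qed.

(** Quotients and localizations can thus be built as mere rings: the k-structure comes through the
    morphism from [P]. *)
Lemma algebra_of_rmorphism (k : fieldType) (P : comAlgType k)
    (Q : comNzRingType) (f : {rmorphism P -> Q}) :
  exists (Q' : comAlgType k) (g : {lrmorphism P -> Q'})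
     (u : {rmorphism Q -> Q'}) , bijective u /\ forall x, g x = u (f x).
Proof.
pose iota : {rmorphism k -> Q} := f \o in_alg P.
pose Q' : comAlgType k := alg_of_morphism iota.
have [||a x|g gE] := @lrmorphismP k P Q' f.
- exact: rmorphB.
- by split=> [|x y]; rewrite ?rmorph1 ?rmorphM.
- by rewrite alg_of_morphismE /= -rmorphM /= mulr_algl.
by exists Q', g, idfun; split=> //; exists idfun.
Qed.

(** The proof is a parameter so that an ideal structure can be attached to an arbitrary
    predicate. *)
Definition ideal_of (R : comNzRingType) (I : {pred R})
  of idealr_closed I : {pred R} := I.
HB.instance Definition _ (R : comNzRingType) (I : {pred R})
  (cI : idealr_closed I) := isIdealr.Build R (ideal_of cI) cI.

Lemma exists_quotient (k : fieldType) (P : comAlgType k) (I : {pred P}) :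
  idealr_closed I ->
  exists (Q : comAlgType k) (p : {lrmorphism P -> Q}),
    (forall x, p x = 0 <-> x \in I) /\ (forall y, exists x, y = p x).
Proof.
move=> cI.
pose Q : comNzRingType := {ideal_quot (ideal_of cI)}.
have [Q' [g [u [[v uK vK] gE]]]] := @algebra_of_rmorphism k P Q (\pi_Q).
exists Q', g; split=> [x|y].
  rewrite gE -[X in _ <-> X]/(is_true (x \in ideal_of cI)) -[x in x \in _]subr0.
  rewrite Quotient.idealrBE raddf0 -(rmorph0 u) -(can_eq uK) -/Q.
  by split=> [->|/eqP ->].
by exists (repr (v y)); rewrite gE /= reprK vK.
Qed.

Lemma quotient_lift (k : fieldType) (P Q T : comAlgType k)
    (p : {lrmorphism P -> Q}) (f : {lrmorphism P -> T}) :
  (forall y, exists x, y = p x) -> (forall x, p x = 0 -> f x = 0) ->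
  exists g : {lrmorphism Q -> T}, forall x, g (p x) = f x.
Proof.
move=> psurj fker.
have [s sP] := choice psurj.
have fs x : f (s (p x)) = f x.
  by apply/eqP; rewrite -subr_eq0 -rmorphB /= fker // rmorphB /= -sP subrr.
have [|||g gE] := @lrmorphismP k Q T (f \o s).
- move=> x y /=; have [[a ->] [b ->]] := (psurj x, psurj y).
  by rewrite -rmorphB !fs rmorphB.
- split=> [|x y] /=; first by rewrite -(rmorph1 p) fs rmorph1.
  have [[a ->] [b ->]] := (psurj x, psurj y).
  by rewrite -rmorphM !fs rmorphM.
- move=> a x /=; have [b ->] := psurj x.
  by rewrite -linearZ !fs linearZ.
by exists g => x; rewrite gE /= fs.
Qed.

Section Subalgebra.
Variables (k : fieldType) (L : comAlgType k) (U : {pred L}).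
Hypothesis cU : subalg_closed U.

Definition subalg_pred of subalg_closed U : {pred L} := U.
HB.instance Definition _ :=
  GRing.isSubalgClosed.Build k L (subalg_pred cU) cU.
Record subalg := Subalg { subalg_val :> L; _ : subalg_val \in subalg_pred cU }.
HB.instance Definition _ := [isSub for subalg_val].
HB.instance Definition _ := [Choice of subalg by <:].
HB.instance Definition _ := [SubChoice_isSubComNzRing of subalg by <:].
HB.instance Definition _ := [SubZmodule_isSubLmodule of subalg by <:].
HB.instance Definition _ := [SubNzRing_SubLmodule_isSubLalgebra of subalg by <:].
HB.instance Definition _ := [SubLalgebra_isSubAlgebra of subalg by <:].

End Subalgebra.

Lemma exists_subalgebra (k : fieldType) (L : comAlgType k) (U : {pred L}) :
  subalg_closed U ->
  exists (T : comAlgType k) (j : {lrmorphism T -> L}),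
    injective j /\ forall y, y \in U <-> exists x, y = j x.
Proof.
move=> cU; pose v : subalg cU -> L := @subalg_val _ _ _ cU.
have [|||j jE] := @lrmorphismP k (subalg cU) L v.
- by move=> x y; apply: (raddfB (\val : {additive subalg cU -> L})).
- by split=> [|x y]; [apply: (rmorph1 (\val : {rmorphism subalg cU -> L}))
    | apply: (rmorphM (\val : {rmorphism subalg cU -> L}))].
- by move=> a x; apply: (linearZZ (\val : {linear subalg cU -> L})).
exists (subalg cU), j; split=> [x y|y]; first by rewrite !jE => /val_inj.
split=> [yU|[x ->]]; last by rewrite jE; apply: (valP x).
by exists (Subalg (yU : y \in subalg_pred cU)); rewrite jE.
Qed.

Lemma subalgebra_corestrict (k : fieldType) (S T L : comAlgType k)
    (j : {lrmorphism T -> L}) (f : {lrmorphism S -> L}) :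
  injective j -> (forall x, exists y, f x = j y) ->
  exists g : {lrmorphism S -> T}, forall x, j (g x) = f x.
Proof.
move=> inj_j /choice [s sP].
have [|||g gE] := @lrmorphismP k S T s.
- by move=> x y; apply: inj_j; rewrite [RHS]rmorphB /= -!sP rmorphB.
- by split=> [|x y]; apply: inj_j; rewrite [RHS](rmorph1, rmorphM) /= -!sP (rmorph1, rmorphM).
- by move=> a x; apply: inj_j; rewrite [RHS]linearZ /= -!sP linearZ.
by exists g => x; rewrite gE -sP.
Qed.

(** * Localization at a prime ideal *)

Section Localization.
Variables (R : comNzRingType) (P : {pred R}).
Hypotheses (idlP : idealr_closed P) (prP : prime_idealr_closed P).

Fact loc_den1 : 1 \notin P. Proof. by case: idlP. Qed.
Fact loc_denM x y : x \notin P -> y \notin P -> x * y \notin P.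
Proof. by move=> /negPf xP /negPf yP; apply/negP => /prP; rewrite xP yP. Qed.

Record loc_frac := LocFrac { loc_num : R; loc_den : R; loc_denP : loc_den \notin P }.

Definition loc_frac_pair (x : loc_frac) : {x : R * R | x.2 \notin P} :=
  exist _ (loc_num x, loc_den x) (loc_denP x).
Definition loc_pair_frac (x : {x : R * R | x.2 \notin P}) : loc_frac :=
  LocFrac (val x).1 (valP x).
Fact loc_frac_pairK : cancel loc_frac_pair loc_pair_frac.
Proof. by case=> a s sP; congr LocFrac; apply: bool_irrelevance. Qed.
HB.instance Definition _ := Choice.copy loc_frac (can_type loc_frac_pairK).

(** The factor [u] is what makes the relation transitive when R has zero divisors. *)
Definition loc_equiv (x y : loc_frac) : bool :=
  `[< exists2 u, u \notin P
        & u * (loc_num x * loc_den y) = u * (loc_num y * loc_den x) >].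

Fact loc_equiv_refl : reflexive loc_equiv.
Proof. by move=> x; apply/asboolP; exists 1; rewrite ?loc_den1. Qed.

Fact loc_equiv_sym x y : loc_equiv x y = loc_equiv y x.
Proof. by apply/idP/idP => /asboolP [u uP uE]; apply/asboolP; exists u. Qed.

Fact loc_equiv_trans : transitive loc_equiv.
Proof.
move=> y x z /asboolP [u uP uE] /asboolP [v vP vE]; apply/asboolP.
exists (u * v * loc_den y); first by rewrite !loc_denM ?loc_denP.
transitivity (v * loc_den z * (u * (loc_num x * loc_den y))); first by ring.
rewrite uE; transitivity (u * loc_den x * (v * (loc_num y * loc_den z))).
  by ring.
by rewrite vE; ring.
Qed.

Canonical loc_equiv_equiv :=
  EquivRel loc_equiv loc_equiv_refl loc_equiv_sym loc_equiv_trans.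

Definition loc := {eq_quot loc_equiv}.
HB.instance Definition _ := EqQuotient.on loc.
HB.instance Definition _ := Choice.on loc.

Lemma loc_eqP x y :
  reflect (exists2 u, u \notin P
             & u * (loc_num x * loc_den y) = u * (loc_num y * loc_den x))
          (\pi_loc x == \pi_loc y).
Proof. by rewrite eqmodE; apply: asboolP. Qed.

Lemma loc_pi_eq x y u : u \notin P ->
  u * (loc_num x * loc_den y) = u * (loc_num y * loc_den x) ->
  \pi_loc x = \pi_loc y.
Proof. by move=> uP uE; apply/eqP/loc_eqP; exists u. Qed.

Lemma loc_reprP (x : loc_frac) : exists2 u, u \notin P
  & u * (loc_num (repr (\pi_loc x)) * loc_den x) =
    u * (loc_num x * loc_den (repr (\pi_loc x))).
Proof. by apply/loc_eqP; rewrite reprK. Qed.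

Definition loc_fracD x y :=
  LocFrac (loc_num x * loc_den y + loc_num y * loc_den x)
          (loc_denM (loc_denP x) (loc_denP y)).
Definition loc_fracM x y :=
  LocFrac (loc_num x * loc_num y) (loc_denM (loc_denP x) (loc_denP y)).
Definition loc_fracN x := LocFrac (- loc_num x) (loc_denP x).
Definition loc_fracC a := LocFrac a loc_den1.

Definition loc_add (x y : loc) : loc := \pi_loc (loc_fracD (repr x) (repr y)).
Definition loc_mul (x y : loc) : loc := \pi_loc (loc_fracM (repr x) (repr y)).
Definition loc_opp (x : loc) : loc := \pi_loc (loc_fracN (repr x)).

Lemma loc_addE x y : loc_add (\pi_loc x) (\pi_loc y) = \pi_loc (loc_fracD x y).
Proof.
rewrite /loc_add.
case: (loc_reprP x) (loc_reprP y); move: (repr _) => x' u uP uE.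
move: (repr _) => y' [v vP vE].
apply: (@loc_pi_eq _ _ (u * v)); first exact: loc_denM.
rewrite /loc_fracD /=.
transitivity (v * loc_den y * loc_den y' * (u * (loc_num x' * loc_den x))
   + u * loc_den x * loc_den x' * (v * (loc_num y' * loc_den y))); first by ring.
by rewrite uE vE; ring.
Qed.

Lemma loc_mulE x y : loc_mul (\pi_loc x) (\pi_loc y) = \pi_loc (loc_fracM x y).
Proof.
rewrite /loc_mul.
case: (loc_reprP x) (loc_reprP y); move: (repr _) => x' u uP uE.
move: (repr _) => y' [v vP vE].
apply: (@loc_pi_eq _ _ (u * v)); first exact: loc_denM.
rewrite /loc_fracM /=.
transitivity ((u * (loc_num x' * loc_den x)) * (v * (loc_num y' * loc_den y))).
  by ring.
by rewrite uE vE; ring.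
Qed.

Lemma loc_oppE x : loc_opp (\pi_loc x) = \pi_loc (loc_fracN x).
Proof.
rewrite /loc_opp; case: (loc_reprP x); move: (repr _) => x' u uP uE.
by apply: (loc_pi_eq uP); rewrite /= !mulNr !mulrN uE.
Qed.

Let loc_pi1 x y : loc_num x * loc_den y = loc_num y * loc_den x ->
  \pi_loc x = \pi_loc y.
Proof. by move=> E; apply: (loc_pi_eq loc_den1); rewrite E. Qed.

Fact loc_addA : associative loc_add.
Proof.
elim/quotW=> x; elim/quotW=> y; elim/quotW=> z.
rewrite (loc_addE y z) (loc_addE x y) (loc_addE x) (loc_addE _ z).
by apply: loc_pi1; rewrite /=; ring.
Qed.
Fact loc_addC : commutative loc_add.
Proof.
elim/quotW=> x; elim/quotW=> y.
by rewrite (loc_addE x y) (loc_addE y x); apply: loc_pi1; rewrite /=; ring.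
Qed.
Fact loc_add0 : left_id (\pi_loc (loc_fracC 0)) loc_add.
Proof.
by elim/quotW=> x; rewrite (loc_addE _ x); apply: loc_pi1; rewrite /=; ring.
Qed.
Fact loc_addN : left_inverse (\pi_loc (loc_fracC 0)) loc_opp loc_add.
Proof.
elim/quotW=> x; rewrite (loc_oppE x) (loc_addE _ x).
by apply: loc_pi1; rewrite /=; ring.
Qed.
HB.instance Definition _ :=
  GRing.isZmodule.Build loc loc_addA loc_addC loc_add0 loc_addN.

Fact loc_mulA : associative loc_mul.
Proof.
elim/quotW=> x; elim/quotW=> y; elim/quotW=> z.
rewrite (loc_mulE y z) (loc_mulE x y) (loc_mulE x) (loc_mulE _ z).
by apply: loc_pi1; rewrite /=; ring.
Qed.
Fact loc_mulC : commutative loc_mul.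
Proof.
elim/quotW=> x; elim/quotW=> y.
by rewrite (loc_mulE x y) (loc_mulE y x); apply: loc_pi1; rewrite /=; ring.
Qed.
Fact loc_mul1 : left_id (\pi_loc (loc_fracC 1)) loc_mul.
Proof.
by elim/quotW=> x; rewrite (loc_mulE _ x); apply: loc_pi1; rewrite /=; ring.
Qed.
Fact loc_mulDl : left_distributive loc_mul loc_add.
Proof.
elim/quotW=> x; elim/quotW=> y; elim/quotW=> z.
rewrite (loc_addE x y) (loc_mulE _ z) (loc_mulE x) (loc_mulE y) (loc_addE (loc_fracM x z)).
by apply: loc_pi1; rewrite /=; ring.
Qed.
Fact loc_1neq0 : \pi_loc (loc_fracC 1) != 0.
Proof.
case: idlP => P0 _ _.
apply/loc_eqP => -[u uP]; rewrite /= mul0r mulr0 !mulr1 => u0.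
by rewrite u0 P0 in uP.
Qed.
HB.instance Definition _ := GRing.Zmodule_isComNzRing.Build loc
  loc_mulA loc_mulC loc_mul1 loc_mulDl loc_1neq0.

Definition loc_of (a : R) : loc := \pi_loc (loc_fracC a).

Fact loc_of_zmod : zmod_morphism loc_of.
Proof.
move=> a b; change (loc_of (a - b) = loc_add (loc_of a) (loc_opp (loc_of b))).
rewrite [loc_opp _](loc_oppE (loc_fracC b)).
apply: etrans (esym (loc_addE (loc_fracC a) _)).
by apply: loc_pi1; rewrite /=; ring.
Qed.
HB.instance Definition _ := GRing.isZmodMorphism.Build R loc loc_of loc_of_zmod.
Fact loc_of_monoid : monoid_morphism loc_of.
Proof.
split=> // a b; apply: etrans (esym (loc_mulE (loc_fracC a) (loc_fracC b))).
by apply: loc_pi1; rewrite /=; ring.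
Qed.
HB.instance Definition _ :=
  GRing.isMonoidMorphism.Build R loc loc_of loc_of_monoid.

Lemma loc_of_unit s : s \notin P -> exists y, loc_of s * y = 1.
Proof.
move=> sP; exists (\pi_loc (LocFrac 1 sP)).
apply: etrans (loc_mulE (loc_fracC s) _) _.
by apply: loc_pi1; rewrite /=; ring.
Qed.

Lemma loc_of_surj y : exists a s, s \notin P /\ loc_of s * y = loc_of a.
Proof.
elim/quotW: y => -[a s sP]; exists a, s; split=> //.
apply: etrans (loc_mulE (loc_fracC s) _) _.
by apply: loc_pi1; rewrite /=; ring.
Qed.

Lemma loc_of_eq0 a : loc_of a = 0 -> exists2 s, s \notin P & s * a = 0.
Proof.
move=> /eqP /loc_eqP [u uP /=]; rewrite mul0r mulr0 mulr1 => uE.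
by exists u.
Qed.

End Localization.

(** These three properties determine R_P; the upper bound works from them and never from the
    construction. *)
Lemma exists_localization (k : fieldType) (R : comAlgType k) (P : {pred R}) :
  idealr_closed P -> prime_idealr_closed P ->
  exists (L : comAlgType k) (f : {lrmorphism R -> L}),
    [/\ forall s, s \notin P -> exists y, f s * y = 1,
        forall y, exists a s, s \notin P /\ f s * y = f a
      & forall a, f a = 0 -> exists2 s, s \notin P & s * a = 0].
Proof.
move=> idlP prP.
have [L [f [u [[v uK vK] fE]]]] := algebra_of_rmorphism (@loc_of R P idlP prP).
exists L, f; split=> [s sP|y|a].
- have [y sy1] := loc_of_unit idlP prP sP; exists (u y).
  by rewrite fE -rmorphM sy1 rmorph1.
- have [a [s [sP E]]] := loc_of_surj (v y); exists a, s; split=> //.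
  by rewrite !fE -[y]vK -rmorphM E.
- by rewrite fE -(rmorph0 u) => /(can_inj uK) /loc_of_eq0.
Qed.

(** * Chains of primes in polynomial rings *)

Lemma mpoly_eval (k : fieldType) (N : nat) (T : comAlgType k) (pt : 'I_N -> T) :
  exists f : {lrmorphism {mpoly k[N]} -> T}, forall i, f 'X_i = pt i.
Proof.
pose f : {mpoly k[N]} -> T := mmap (in_alg T) pt.
have [|||g gE] := @lrmorphismP k {mpoly k[N]} T f.
- by move=> x y; apply: raddfB.
- by split=> [|x y]; [apply: (rmorph1 (mmap (in_alg T) pt))
    | apply: (rmorphM (mmap (in_alg T) pt))].
- by move=> a x; rewrite /f mmapZ /= mulr_algl.
by exists g => i; rewrite gE /f mmapX mmap1U.
Qed.

Lemma mpoly_lrmorphism_eq (k : fieldType) (N : nat) (T : comAlgType k)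
    (f h : {lrmorphism {mpoly k[N]} -> T}) :
  (forall i, f 'X_i = h 'X_i) -> f =1 h.
Proof.
move=> fhX p; rewrite [p]mpolyE !linear_sum; apply: eq_bigr => m _ /=.
rewrite !linearZ; congr (_ *: _); rewrite mpolyXE_id !rmorph_prod.
by apply: eq_bigr => i _; rewrite !rmorphXn /= fhX.
Qed.

Section AlgebraicDependence.
Variables (k : fieldType) (P : comAlgType k) (D : nat) (F : nat -> P).

(** The value at F i, ..., F (i + n - 1) of the polynomial whose coefficients [c] are indexed by
    lists of exponents below D. The nesting singles out the powers of F i, so that an induction can
    remove one variable at a time. *)
Fixpoint nested (n : nat) (c : seq nat -> k) (i : nat) : P :=
  if n is n'.+1
  then \sum_(j < D) F i ^+ j * nested n' (fun s => c (val j :: s)) i.+1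
  else (c [::])%:A.

Lemma nestedE n c i : nested n c i =
  \sum_(t : n.-tuple 'I_D) c (map val t) *: \prod_(l < n) F (i + l)%N ^+ tnth t l.
Proof.
elim: n c i => [|n IHn] c i /=.
  rewrite (big_pred1 [tuple]) => [|t]; last by rewrite /= (tuple0 t); apply/esym/eqP.
  by rewrite big_ord0.
pose h (p : 'I_D * n.-tuple 'I_D) := [tuple of p.1 :: p.2].
rewrite (reindex h) /=; last first.
  exists (fun t => (thead t, [tuple of behead t])) => [[j t] _|t _].
    by congr (_, _); apply: val_inj.
  by rewrite /h /= [t in RHS]tuple_eta.
rewrite -(pair_bigA _ (fun j t => c (val j :: map val (val t)) *:
  \prod_(l < n.+1) F (i + l)%N ^+ tnth (h (j, t)) l)) /=.
apply: eq_bigr => j _; rewrite IHn mulr_sumr; apply: eq_bigr => t _.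
rewrite -scalerAr big_ord_recl addn0; congr (_ *: (_ * _)).
apply: eq_bigr => l _; rewrite tnthS addSnnS; congr (F (_ + _)%N ^+ _).
Qed.

(* If some coefficient is nonzero, divide by the lowest power of F i that
   occurs; modulo the prime Q i.+1, which contains F i, one variable is gone. *)
Lemma nested_prime_chain (Q : nat -> {pred P}) n c i :
  (forall l, (i <= l <= i + n)%N ->
     idealr_closed (Q l) /\ prime_idealr_closed (Q l)) ->
  (forall l, (i <= l < i + n)%N ->
     [/\ {subset Q l <= Q l.+1}, F l \in Q l.+1 & F l \notin Q l]) ->
  nested n c i \in Q i ->
  forall s, size s = n -> all (ltn^~ D) s -> c s = 0.
Proof.
elim: n c i => [|n IHn] c i prQ stepQ /=.
  move=> cQ [] // _ _; apply/eqP/negPn/negP => c0.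
  have [] := prQ i; first by rewrite leqnn leq_addr.
  move=> [Q0 /negP Q1 QD] _; apply: Q1.
  by have := QD (c [::])^-1%:A _ _ cQ Q0; rewrite addr0 mulr_algl scalerA mulVf // scale1r.
have [[Q0 _ QD] prQi] := prQ i (introT andP (conj (leqnn i) (leq_addr _ _))).
have [|subQ FQ' FQ] := stepQ i; first by rewrite leqnn addnS ltnS leq_addr.
have [|[Q'0 _ Q'D] prQ'] := prQ i.+1; first by rewrite leqnSn addnS ltnS leq_addr.
move=> cQ; pose S j := nested n (fun s => c (j :: s)) i.+1.
have SQ' j : (j < D)%N -> S j \in Q i.+1 -> forall s, size s = n ->
    all (ltn^~ D) s -> c (j :: s) = 0.
  move=> jD SjQ; apply: IHn SjQ => l /andP [il ln].
    by apply: prQ; rewrite (ltnW il) /= addnS -addSn.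
  by apply: stepQ; rewrite (ltnW il) /= addnS -addSn.
(* Induction on the exponent of F i: once the coefficients of all lower powers vanish, F i ^ j can
   be factored out. *)
suff H j : (j <= D)%N -> forall s j', (j' < j)%N -> size s = n ->
    all (ltn^~ D) s -> c (j' :: s) = 0.
  by move=> [|j s] //= [sn] /andP [jD sD]; apply: (H D).
elim: j => [|j IHj] jD s j' //; rewrite ltnS leq_eqVlt => /orP [/eqP->|]; last first.
  by move=> ?; apply: IHj => //; apply: ltnW.
move: s; apply: SQ' => //.
have S0 l : (l < j)%N -> S l = 0.
  move=> lj; rewrite /S nestedE big1 // => t _.
  rewrite (IHj _ (map val t)) ?scale0r ?(ltnW jD) ?size_map ?size_tuple //.
  by apply/allP => _ /mapP [x _ ->]; apply: (ltn_ord x).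
have {}cQ : F i ^+ j * \sum_(l < D | (j <= l)%N) F i ^+ (l - j) * S l \in Q i.
  move: cQ => /=; rewrite (bigID (fun l : 'I_D => (j <= l)%N)) /=.
  rewrite [X in _ + X]big1 ?addr0 => [cQ|l]; last first.
    by rewrite -ltnNge => /S0 E; rewrite -/(S l) E mulr0.
  rewrite mulr_sumr (eq_bigr (fun l : 'I_D => F i ^+ l * S l)) // => l jl.
  by rewrite mulrA -exprD subnKC.
have FjQ : F i ^+ j \notin Q i.
  elim: (j) => [|l /negPf lQ]; first by case: (prQ i) => [|[_ + _] _] //;
    rewrite leqnn leq_addr.
  by apply/negP; rewrite exprS => /prQi; rewrite lQ (negPf FQ).
have /subQ {}cQ : \sum_(l < D | (j <= l)%N) F i ^+ (l - j) * S l \in Q i.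
  by have /orP [] // := prQi _ _ cQ; rewrite (negPf FjQ).
move: cQ; rewrite (bigD1 (Ordinal jD)) //= subnn expr0 mul1r.
set r := (X in _ + X) => SrQ.
have rQ : r \in Q i.+1.
  rewrite /r; elim/big_ind: _ => // [x y xQ yQ|l /andP [jl lj]].
    by rewrite -[x]mul1r Q'D.
  have {}jl : (j < l)%N.
    by rewrite ltn_neqAle jl andbT; apply: contraNneq lj => E; apply/eqP/val_inj.
  rewrite -(subnSK jl) exprS mulrAC -mulrA mulrC.
  by rewrite -[X in X \in _]addr0; apply: Q'D.
by rewrite -(addrK r (S j)) addrC -mulN1r Q'D.
Qed.
End AlgebraicDependence.

(** The strict hypothesis compensates for the successor lost at each product in [msizeM_le]. *)
Lemma msize_exp_le (k : fieldType) (N d e : nat) (p : {mpoly k[N]}) :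
  (msize p < d)%N -> (msize (p ^+ e) <= (e * d).+1)%N.
Proof.
move=> pd; elim: e => [|e IHe]; first by rewrite expr0 msize1.
rewrite exprS; apply: leq_trans (msizeM_le _ _) _.
by rewrite mulSn -addSn -addnS leq_add.
Qed.

Lemma msize_prod_le (k : fieldType) (N d n : nat) (p : 'I_n -> {mpoly k[N]}) :
  (forall i, msize (p i) < d)%N -> (msize (\prod_i p i) <= (n * d).+1)%N.
Proof.
elim: n p => [|n IHn] p pd; first by rewrite big_ord0 msize1.
rewrite big_ord_recl; apply: leq_trans (msizeM_le _ _) _.
by rewrite mulSn -addSn -addnS leq_add // IHn.
Qed.

(* There are D ^ n monomials in the F l with exponents < D; for large D this
   exceeds the number L ^ N of monomials in N variables with exponents < L,
   where L = O(D) bounds the degrees that occur. *)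
Lemma mpoly_dependence (k : fieldType) (N n : nat) (F : nat -> {mpoly k[N]}) :
  (N < n)%N ->
  exists (D : nat) (c : seq nat -> k), nested D F n c 0 = 0 /\
    exists s, [/\ size s = n, all (ltn^~ D) s & c s != 0].
Proof.
move=> Nn; pose d := (\max_(l < n) msize (F l)).+3.
(* [D] is chosen so that L ^ N = (n * d) ^ N * D ^ N < D ^ (N + 1) <= D ^ n. *)
pose D := ((n * d) ^ N).+1; pose L := (n * (D * d))%N.
have n0 : (0 < n)%N by apply: leq_trans Nn.
have LD : (L ^ N < D ^ n)%N.
  rewrite /L mulnCA expnMn; apply: leq_trans (leq_pexp2l (ltn0Sn _) Nn).
  by rewrite [X in (_ < X)%N]expnSr ltn_pmul2l ?expn_gt0 // ltnSn.
pose E (t : n.-tuple 'I_D) : {mpoly k[N]} := \prod_(l < n) F l ^+ tnth t l.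
pose mon (f : {ffun 'I_N -> 'I_L}) : 'X_{1..N} := [multinom val (f i) | i < N].
pose M := \matrix_(a < #|{: n.-tuple 'I_D}|, b < #|{: {ffun 'I_N -> 'I_L}}|)
   (E (enum_val a))@_(mon (enum_val b)).
have /rowV0Pn [v /sub_kermxP vM v0] : kermx M != 0.
  rewrite kermx_eq0 -row_leq_rank -ltnNge; apply: leq_ltn_trans (rank_leq_col _) _.
  by rewrite card_tuple card_ffun !card_ord.
(* Extends the kernel vector [v] to all lists: the sum has at most one term, and none for a list
   that is not some [map val t]. *)
pose c (s : seq nat) := \sum_(t : n.-tuple 'I_D | map val t == s) v 0 (enum_rank t).
have cE t : c (map val (val t)) = v 0 (enum_rank t).
  rewrite /c (big_pred1 t) // => t'; apply/eqP/eqP => [|-> //].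
  by move/(inj_map val_inj)/val_inj.
exists D, c; split; last first.
  have /rV0Pn [a va] := v0; exists (map val (val (enum_val a))).
  rewrite cE enum_valK size_map size_tuple va; split=> //.
  by apply/allP => _ /mapP [x _ ->]; apply: (ltn_ord x).
have EL t : (msize (E t) <= L)%N.
  apply: leq_trans (_ : (n * (D.-1 * d).+2).+1 <= _)%N.
    apply: msize_prod_le => l; rewrite ltnS.
    apply: leq_trans (_ : (tnth t l * d).+1 <= _)%N; last first.
      by rewrite ltnS leq_mul // -ltnS (ltn_predK (ltn_ord (tnth t l))).
    apply: msize_exp_le; rewrite /d ltnS.
    apply: leq_trans (@leq_bigmax _ (fun l : 'I_n => msize (F l)) l) _.
    by rewrite -addn2 leq_addr.
  apply: leq_trans (_ : n * (D.-1 * d).+3 <= _)%N.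
    by rewrite [X in (_ <= X)%N]mulnS addnC -addn1 leq_add2l.
  by rewrite /L leq_mul // mulSn -addn3 addnC leq_add.
rewrite nestedE; apply/mpolyP => m; rewrite mcoeff0.
(* A monomial of degree at least L occurs in no [E t]; any other has all exponents below L and so is
   a column of [M]. *)
have [mL|mL] := leqP L (mdeg m).
  rewrite raddf_sum big1 // => t _; rewrite /= mcoeffZ memN_msupp_eq0 ?mulr0 //.
  by apply: msize_mdeg_ge; apply: leq_trans mL; apply: EL.
have mi i : (m i < L)%N.
  by apply: leq_ltn_trans mL; rewrite mdegE (bigD1 i) //= leq_addr.
pose b := [ffun i => Ordinal (mi i)].
have -> : m = mon b by apply/mnmP => i; rewrite mnmE ffunE.
have := congr1 (fun r : 'rV_ _ => r 0 (enum_rank b)) vM; rewrite !mxE => vMb.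
rewrite -[RHS]vMb raddf_sum (reindex _ (onW_bij _ (@enum_val_bij _))) /=.
apply: eq_bigr => a _; rewrite mcoeffZ mxE cE enum_valK enum_rankK.
by congr (_ * (_)@_ _); apply: eq_bigr => l _; rewrite add0n.
Qed.

(** Choose F l in Q l.+1 outside Q l. More than N polynomials in N variables are algebraically
    dependent, while [nested_prime_chain] forces every relation among the F l to be trivial. *)
Theorem mpoly_prime_chain (k : fieldType) (N e : nat) (Q : nat -> {pred {mpoly k[N]}}) :
  prime_chain e Q -> (e <= N)%N.
Proof.
move=> [prQ stepQ]; rewrite leqNgt; apply/negP => Ne.
have /choice [F FP] l : exists x, (l < e)%N -> x \in Q l.+1 /\ x \notin Q l.
  have [le|] := ltnP l e; last by exists 0.
  by have [_ [x xQ' xQ]] := stepQ _ le; exists x.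
have [D [c [c0 [s [sn sD]]]]] := mpoly_dependence F Ne.
apply/negP/negPn/eqP; apply: (@nested_prime_chain _ _ D F Q e c 0) => //.
- by move=> l; rewrite add0n => le; case: (FP _ le) (stepQ _ le) => ? ? [].
- by rewrite c0; case: (prQ 0) => // -[].
Qed.

(** * The monomial basis *)

Section Basis.
Variables (m : nat) (c : 'I_m -> nat) (c_gt0 : forall i, (0 < c i)%N).

(* [None] indexes 1 and [Some (i, j)] indexes t_i ^ (j + 1). *)
Definition bidx : finType := option {i : 'I_m & 'I_(c i).-1}.

Definition bmon (x : bidx) : 'X_{1..m} :=
  if x is Some y then (U_(tag y) *+ (tagged y).+1)%MM else 0%MM.

Lemma bmonE (i : 'I_m) (j : 'I_(c i).-1) :
  bmon (Some (Tagged (fun i => 'I_(c i).-1) j)) = (U_(i) *+ j.+1)%MM.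
Proof. by []. Qed.

Lemma card_bidx : #|{: bidx}| = ((\sum_i c i) - m).+1.
Proof.
rewrite card_option card_tagged sumnE big_map big_enum /=; congr _.+1.
rewrite (eq_bigr (fun i => c i - 1)%N) => [|i _]; last by rewrite card_ord subn1.
by rewrite sumnB ?sum1_card ?card_ord // => i _; apply: c_gt0.
Qed.

Lemma bmon_lt (x : bidx) i : (bmon x i < c i)%N.
Proof.
case: x => [[i' j]|]; last by rewrite mnm0E.
rewrite mulmnE mnm1E /=; case: eqP => [<-|_]; last by rewrite mul0n.
by rewrite mul1n -ltn_predRL ltn_ord.
Qed.

Lemma bmon_one (x : bidx) i j : i != j -> (bmon x i == 0) || (bmon x j == 0)%N.
Proof.
case: x => [[i' l]|] ij; last by rewrite mnm0E.
rewrite !mulmnE !mnm1E /=; have [E|_] := eqVneq i' i; last by rewrite mul0n.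
by rewrite -E in ij; rewrite (negPf ij) mul0n orbT.
Qed.

Lemma bmonP (k : 'X_{1..m}) : (forall i, (k i < c i)%N) ->
  (forall i j, i != j -> (k i == 0) || (k j == 0)%N) -> exists x, k = bmon x.
Proof.
move=> kc k1; have [k0|] := boolP [forall i, k i == 0%N].
  by exists None; apply/mnmP => i; rewrite mnm0E; apply/eqP/(forallP k0).
rewrite negb_forall => /existsP [i ki].
have kE : (k i).-1.+1 = k i by rewrite prednK // lt0n.
have kl : ((k i).-1 < (c i).-1)%N.
  by rewrite ltn_predRL kE kc.
exists (Some (Tagged (fun i => 'I_(c i).-1) (Ordinal kl))).
rewrite bmonE /= kE; apply/mnmP => j; rewrite mulmnE mnm1E.
have [<-|ij] := eqVneq i j; first by rewrite mul1n.
by have := k1 _ _ ij; rewrite (negPf ki) mul0n => /eqP.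
Qed.

Lemma bmon_inj : injective bmon.
Proof.
have c_inj (i i' : 'I_m) a b : (U_(i) *+ a.+1 = U_(i') *+ b.+1)%MM ->
    i = i' /\ a = b.
  move=> /mnmP E; have := E i; rewrite !mulmnE !mnm1E eqxx mul1n.
  by case: eqP => [->|_]; rewrite ?mul1n ?mul0n // => -[->].
move=> [[i j]|] [[i' j']|] //= E.
- have [ii' jj'] := c_inj _ _ _ _ E; subst i'.
  by congr (Some (Tagged _ _)); apply: val_inj.
- by have /mnmP/(_ i) := E; rewrite mulmnE mnm1E eqxx mnm0E.
- by have /mnmP/(_ i') := E; rewrite mulmnE mnm1E eqxx mnm0E.
Qed.

Section Coef.
Variable R : comNzRingType.
Local Notation A := (Aplus c_gt0 R).
Local Notation cst := (Aplus_cst c_gt0).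

Lemma mcoeffMX0 (p : {mpoly R[m]}) (k l : 'X_{1..m}) i :
  (k i < l i)%N -> (p * 'X_[l])@_k = 0.
Proof.
move=> kl; rewrite mcoeffM big1 // => -[a b] /= /eqP kE.
rewrite mcoeffX; case: eqP => [lE|_]; last by rewrite mulr0.
by have := congr1 (fun k : 'X_{1..m} => k i) kE; move: kl;
   rewrite lE mnmDE => /[swap] ->; rewrite ltnNge leq_addl.
Qed.

(** Together with [Aplus_idealX], this identifies the ideal as the span of the monomials outside the
    image of [bmon]; the remaining ones are therefore a basis of the quotient. *)
Lemma Aplus_ideal_coef (f : {mpoly R[m]}) x :
  f \in Aplus_ideal c_gt0 (R := R) -> f@_(bmon x) = 0.
Proof.
case/Aplus_idealP => u [v ->]; rewrite mcoeffD !raddf_sum /= !big1 ?addr0 //.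
  move=> i _; rewrite raddf_sum big1 // => j ij /=.
  rewrite -mpolyXD; have /orP [/eqP xi|/eqP xj] := bmon_one x ij.
    by apply: (@mcoeffMX0 _ _ _ i); rewrite xi mnmDE mnm1E eqxx.
  by apply: (@mcoeffMX0 _ _ _ j); rewrite xj mnmDE [U_(j)%MM j]mnm1E eqxx addn1.
move=> i _; rewrite mpolyXn; apply: (@mcoeffMX0 _ _ _ i).
by rewrite mulmnE mnm1E eqxx mul1n bmon_lt.
Qed.

Lemma Aplus_idealX (k : 'X_{1..m}) : (forall x, k != bmon x) ->
  ('X_[k] : {mpoly R[m]}) \in Aplus_ideal c_gt0 (R := R).
Proof.
move=> kx.
have idM (p q : {mpoly R[m]}) : q \in Aplus_ideal c_gt0 (R := R) ->
    p * q \in Aplus_ideal c_gt0 (R := R) by apply: idealMr.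
have [/existsP [i ik]|] := boolP [exists i, (c i <= k i)%N].
  have -> : k = (k - U_(i) *+ c i + U_(i) *+ c i)%MM.
    rewrite submK //; apply/mnm_lepP => j; rewrite mulmnE mnm1E.
    by case: eqP => [<-|_]; rewrite ?mul1n ?mul0n.
  rewrite mpolyXD; apply: idM; apply/Aplus_idealP.
  exists (fun i' => (i' == i)%:R), (fun _ _ => 0).
  rewrite (bigD1 i) //= eqxx mul1r mpolyXn !big1 ?addr0 // => j.
    by move=> _; rewrite big1 // => l _; rewrite mul0r.
  by move=> /negPf ->; rewrite mul0r.
rewrite negb_exists => /forallP kc.
have [/existsP [i /existsP [j /and3P [ij ki kj]]]|] :=
    boolP [exists i, exists j, [&& i != j, k i != 0 & k j != 0]%N].
  have -> : k = (k - (U_(i) + U_(j)) + (U_(i) + U_(j)))%MM.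
    rewrite submK //; apply/mnm_lepP => l; rewrite mnmDE !mnm1E.
    have [<-|_] := eqVneq i l; first by rewrite eq_sym (negPf ij) addn0 lt0n.
    by have [<-|_] := eqVneq j l; first by rewrite add0n lt0n.
  rewrite mpolyXD; apply: idM; apply/Aplus_idealP.
  exists (fun _ => 0), (fun i' j' => ((i' == i) && (j' == j))%:R).
  rewrite big1 ?add0r => [|l _]; last by rewrite mul0r.
  rewrite (bigD1 i) //= (bigD1 j) //= !eqxx mul1r -mpolyXD !big1 ?addr0 //.
    by move=> l /negPf li; rewrite big1 // => l' _; rewrite li mul0r.
  by move=> l /andP [_ /negPf ->]; rewrite andbF mul0r.
rewrite negb_exists => /forallP k1; exfalso.
have [||x kE] := @bmonP k; last by have := kx x; rewrite kE eqxx.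
  by move=> i; rewrite ltnNge kc.
move=> i j ij; have := k1 i; rewrite negb_exists => /forallP/(_ j).
by rewrite ij /= negb_and !negbK.
Qed.

Definition bcoef (x : bidx) (a : A) : R := (repr a)@_(bmon x).
Definition bvec (x : bidx) : A := \pi_A 'X_[bmon x].

Lemma bcoef_pi (f : {mpoly R[m]}) x : bcoef x (\pi_A f) = f@_(bmon x).
Proof.
apply/eqP; rewrite -subr_eq0 -mcoeffB; apply/eqP/Aplus_ideal_coef.
by rewrite Quotient.idealrBE reprK.
Qed.

Lemma bcoefB a b x : bcoef x (a - b) = bcoef x a - bcoef x b.
Proof.
by elim/quotW: a => a; elim/quotW: b => b; rewrite -rmorphB !bcoef_pi mcoeffB.
Qed.

Lemma bcoefZ r a x : bcoef x (cst r * a) = r * bcoef x a.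
Proof.
elim/quotW: a => a; rewrite /Aplus_cst -rmorphM /= !bcoef_pi.
by rewrite mul_mpolyC mcoeffZ.
Qed.

Lemma bcoef_bvec y x : bcoef x (bvec y) = (y == x)%:R.
Proof. by rewrite bcoef_pi mcoeffX (inj_eq bmon_inj). Qed.

Lemma bvec_None : bvec None = 1.
Proof. by rewrite /bvec /= mpolyX0 rmorph1. Qed.

Fact Aplus_cst_zmod : zmod_morphism (@Aplus_cst m c c_gt0 R).
Proof. by move=> a b; rewrite /Aplus_cst rmorphB rmorphB. Qed.
Fact Aplus_cst_monoid : monoid_morphism (@Aplus_cst m c c_gt0 R).
Proof. by split=> [|a b]; rewrite /Aplus_cst ?rmorph1 ?rmorphM. Qed.
HB.instance Definition _ :=
  GRing.isZmodMorphism.Build R A (@Aplus_cst m c c_gt0 R) Aplus_cst_zmod.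
HB.instance Definition _ :=
  GRing.isMonoidMorphism.Build R A (@Aplus_cst m c c_gt0 R) Aplus_cst_monoid.

Fact bcoef_zmod x : zmod_morphism (bcoef x).
Proof. by move=> a b; apply: bcoefB. Qed.
HB.instance Definition _ x :=
  GRing.isZmodMorphism.Build A R (bcoef x) (bcoef_zmod x).

Lemma bcoefD a b x : bcoef x (a + b) = bcoef x a + bcoef x b.
Proof. exact: (raddfD (bcoef x)). Qed.

Lemma bcoef_sum (I : Type) (s : seq I) (P : pred I) (F : I -> A) x :
  bcoef x (\sum_(i <- s | P i) F i) = \sum_(i <- s | P i) bcoef x (F i).
Proof. exact: (raddf_sum (bcoef x)). Qed.

Lemma Aplus_expand a : a = \sum_x cst (bcoef x a) * bvec x.
Proof.
elim/quotW: a => p; under eq_bigr => x do rewrite bcoef_pi.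
(* Stated for any list without repetitions, because the support of [p] and the image of [bmon] need
   not contain one another. *)
suff H (s : seq 'X_{1..m}) (f : 'X_{1..m} -> R) : uniq s ->
    (forall k, k \notin s -> f k = 0) ->
    \pi_A (\sum_(k <- s) f k *: 'X_[k]) = \sum_x cst (f (bmon x)) * bvec x.
  rewrite [p in LHS]mpolyE; apply: (H (msupp p) (fun k => p@_k)).
    exact: msupp_uniq.
  by move=> k; apply: memN_msupp_eq0.
move=> s_uniq f0; rewrite rmorph_sum /= (bigID (fun k => [exists x, k == bmon x])) /=.
rewrite [X in _ + X]big1 ?addr0 => [|k]; last first.
  rewrite negb_exists => /forallP kx.
  have /eqP : \pi_A ('X_[k] : {mpoly R[m]}) == \pi_A 0.
    by rewrite -Quotient.idealrBE subr0; apply: Aplus_idealX.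
  rewrite -mul_mpolyC rmorphM /= => ->.
  by rewrite rmorph0 mulr0.
rewrite (eq_bigr (fun k => cst (f k) * \pi_A 'X_[k])) => [|k _]; last first.
  by rewrite -mul_mpolyC rmorphM.
rewrite -[RHS](big_map bmon xpredT (fun k => cst (f k) * \pi_A 'X_[k])).
rewrite -big_filter [RHS](bigID (fun k => k \in s)) /=.
rewrite [X in _ = _ + X]big1 ?addr0 => [|k /f0 ->]; last by rewrite rmorph0 mul0r.
rewrite -[RHS]big_filter; apply: perm_big; apply: uniq_perm.
- exact: filter_uniq.
- by rewrite filter_uniq // map_inj_uniq ?index_enum_uniq //; apply: bmon_inj.
move=> k; rewrite !mem_filter andbC; congr andb.
apply/existsP/mapP => [[x /eqP ->]|[x _ ->]]; last by exists x.
by exists x => //; apply: mem_index_enum.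
Qed.

Lemma bcoef_inj a b : bcoef^~ a =1 bcoef^~ b -> a = b.
Proof.
move=> ab; rewrite [a]Aplus_expand [b]Aplus_expand.
by apply: eq_bigr => x _; rewrite ab.
Qed.

End Coef.

Section Map.
Variables (R S : comNzRingType) (phi : {rmorphism R -> S}).
Local Notation map := (@Aplus_map m c c_gt0 R S phi).

Fact Aplus_map_zmod : zmod_morphism map.
Proof.
move=> a b; elim/quotW: a => a; elim/quotW: b => b.
by rewrite -rmorphB !Aplus_map_pi !rmorphB.
Qed.
Fact Aplus_map_monoid : monoid_morphism map.
Proof.
split=> [|a b].
  by rewrite -(rmorph1 (\pi_(Aplus c_gt0 R))) Aplus_map_pi !rmorph1.
elim/quotW: a => a; elim/quotW: b => b.
by rewrite -rmorphM !Aplus_map_pi !rmorphM.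
Qed.
HB.instance Definition _ := GRing.isZmodMorphism.Build _ _ map Aplus_map_zmod.
HB.instance Definition _ := GRing.isMonoidMorphism.Build _ _ map Aplus_map_monoid.

Lemma bcoef_map a x : bcoef x (map a) = phi (bcoef x a).
Proof. by elim/quotW: a => a; rewrite Aplus_map_pi !bcoef_pi mcoeff_map_mpoly. Qed.

Lemma Aplus_map_cst r : map (Aplus_cst c_gt0 r) = Aplus_cst c_gt0 (phi r).
Proof. by rewrite /Aplus_cst Aplus_map_pi map_mpolyC. Qed.

Lemma Aplus_map_bvec x : map (bvec R x) = bvec S x.
Proof. by rewrite /bvec Aplus_map_pi map_mpolyX. Qed.
End Map.

End Basis.
Arguments bvec {m c} c_gt0 R x.

(** * Base change of subalgebras *)

(** A coarse Cauchy-Binet formula, over all maps instead of subsets. It serves to find minors that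
    are units, that vanish, or that generate the unit ideal, so repetitions do no harm. *)
Lemma det_sum_expand (R : comNzRingType) (I : finType) (n : nat)
    (b : 'I_n -> I -> R) (a : I -> 'I_n -> R) :
  \det (\matrix_(i, l) \sum_y b i y * a y l) =
  \sum_(f : {ffun 'I_n -> I}) (\prod_i b i (f i)) * \det (\matrix_(i, l) a (f i) l).
Proof.
rewrite /determinant.
under eq_bigr => s _ do
  (under eq_bigr => i _ do rewrite mxE; rewrite bigA_distr_bigA mulr_sumr).
rewrite exchange_big; apply: eq_bigr => f _; rewrite mulr_sumr.
apply: eq_bigr => s _; rewrite big_split /= mulrCA; congr (_ * (_ * _)).
by apply: eq_bigr => i _; rewrite mxE.
Qed.

Lemma uniform_exponent (I : finType) (Q : I -> nat -> Prop) :
  (forall i a b, (a <= b)%N -> Q i a -> Q i b) ->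
  (forall i, exists a, Q i a) -> exists a, forall i, Q i a.
Proof.
move=> Qmono /choice [a Qa]; exists (\max_i a i)%N => i.
by apply: Qmono (Qa i); apply: (@leq_bigmax _ a).
Qed.

(** A function that vanishes on a covering by sets D(f_i) is zero: elements having a power that
    kills [a] are closed under sums, so 1 is one of them. *)
Lemma unit_ideal_annihilator (R : comNzRingType) (n : nat) (f h : 'I_n -> R) (a : R) :
  \sum_i h i * f i = 1 -> (forall i, exists N, f i ^+ N * a = 0) -> a = 0.
Proof.
move=> hf1 fa.
suff [N] : exists N, (\sum_i h i * f i) ^+ N * a = 0.
  by rewrite hf1 expr1n mul1r.
elim/big_ind: _ => [|x y [p xp] [q yq]|i _].
- by exists 1%N; rewrite expr1 mul0r.
(* Each term of the binomial expansion contains x ^ p or y ^ q. *)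
- exists (p + q)%N; rewrite exprDn mulr_suml big1 // => i _.
  rewrite mulrnAl; have [qi|iq] := leqP q i.
    by rewrite -(subnK qi) exprD -!mulrA yq !mulr0 mul0rn.
  have -> : (p + q - i = (q - i) + p)%N.
    by transitivity (p + (q - i))%N; [rewrite addnBA // ltnW | apply: addnC].
  by rewrite exprD -!mulrA [x ^+ p * _]mulrCA xp !mulr0 mul0rn.
by have [N fN] := fa i; exists N; rewrite exprMn -mulrA fN mulr0.
Qed.

Section Subalgebras.
Variables (m : nat) (c : 'I_m -> nat) (c_gt0 : forall i, (0 < c i)%N).
Local Notation A R := (Aplus c_gt0 R).
Local Notation cst := (@Aplus_cst m c c_gt0 _).
Local Notation map := (Aplus_map (c_gt0 := c_gt0)).
Local Notation bidx := (bidx c).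

Lemma Aplus_oppE (R : comNzRingType) (a : A R) : - a = cst (-1) * a.
Proof. by rewrite rmorphN rmorph1 mulN1r. Qed.

Section BaseChange.
Variables (R S : comNzRingType) (phi : {rmorphism R -> S}) (B : pred (A R)).
Local Notation BC := (Aplus_base_change phi B).

Lemma base_change_map x : x \in B -> map phi x \in BC.
Proof.
move=> xB; apply/asboolP; exists 1%N, (fun _ => 1), (fun _ => x); split=> //.
by rewrite big_ord1 rmorph1 mul1r.
Qed.

Lemma base_change0 : 0 \in BC.
Proof.
apply/asboolP; exists 0%N, (fun _ => 0), (fun _ => 0).
by split=> [[]//|]; rewrite big_ord0.
Qed.

Lemma base_changeD y z : y \in BC -> z \in BC -> y + z \in BC.
Proof.
move=> /asboolP [n [s [x [xB ->]]]] /asboolP [n' [s' [x' [x'B ->]]]].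
pose pick T (u : 'I_n -> T) (u' : 'I_n' -> T) (i : 'I_(n + n')) :=
  match split i with inl j => u j | inr j => u' j end.
apply/asboolP; exists (n + n')%N, (pick _ s s'), (pick _ x x'); split.
  by move=> i; rewrite /pick; case: split.
rewrite big_split_ord /=; congr (_ + _); apply: eq_bigr => i _; rewrite /pick.
  by rewrite (unsplitK (inl i)).
by rewrite (unsplitK (inr i)).
Qed.

Lemma base_changeZ r y : y \in BC -> cst r * y \in BC.
Proof.
move=> /asboolP [n [s [x [xB ->]]]]; apply/asboolP.
exists n, (fun i => r * s i), x; split=> //.
by rewrite mulr_sumr; apply: eq_bigr => i _; rewrite mulrA -rmorphM.
Qed.

Lemma base_change_ind (Q : A S -> Prop) :
  Q 0 -> (forall y z, Q y -> Q z -> Q (y + z)) ->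
  (forall s x, x \in B -> Q (cst s * map phi x)) ->
  forall y, y \in BC -> Q y.
Proof.
move=> Q0 QD QZ _ /asboolP [n [s [x [xB ->]]]].
by elim/big_ind: _ => // i _; apply: QZ.
Qed.

Lemma base_change_sum (I : Type) (s : seq I) (P : pred I) (F : I -> A S) :
  (forall i, P i -> F i \in BC) -> \sum_(i <- s | P i) F i \in BC.
Proof.
by move=> FB; elim/big_ind: _ => // [|y z]; [apply: base_change0|apply: base_changeD].
Qed.

End BaseChange.

Lemma base_change_comp (R S T : comNzRingType) (phi : {rmorphism R -> S})
    (psi : {rmorphism S -> T}) (chi : {rmorphism R -> T}) (B : pred (A R)) :
  (forall x, chi x = psi (phi x)) ->
  Aplus_base_change psi (Aplus_base_change phi B) = Aplus_base_change chi B.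
Proof.
move=> chiE; have mapE x : map chi x = map psi (map phi x).
  by apply: bcoef_inj => y /=; rewrite !bcoef_map chiE.
apply/funext => y; apply/idP/idP.
  move: y; apply: base_change_ind => [|u v|s y]; [exact: base_change0|exact: base_changeD|].
  move=> yB; apply: base_changeZ; move: y yB.
  apply: base_change_ind => [|u v uB vB|r x xB].
  - by rewrite rmorph0; apply: base_change0.
  - by rewrite rmorphD; apply: base_changeD.
  - rewrite rmorphM /= Aplus_map_cst -mapE; apply: base_changeZ.
    exact: base_change_map.
move: y; apply: base_change_ind => [|u v|s x xB]; [exact: base_change0|exact: base_changeD|].
by rewrite mapE; apply/base_changeZ/base_change_map/base_change_map.
Qed.

Section Subalgebra.
Variables (R : comNzRingType) (B : pred (A R)).
Hypothesis sB : is_subalgebra B.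

Lemma subalgebra1 : 1 \in B. Proof. by case: sB => -[]. Qed.
Lemma subalgebra0 : 0 \in B.
Proof. by case: sB => _ /(_ 0); rewrite rmorph0. Qed.
Lemma subalgebraB : {in B &, forall x y, x - y \in B}.
Proof. by case: sB => -[]. Qed.
Lemma subalgebraN : {in B, forall x, - x \in B}.
Proof. by move=> x xB; rewrite -sub0r subalgebraB // subalgebra0. Qed.
Lemma subalgebraD : {in B &, forall x y, x + y \in B}.
Proof. by move=> x y xB yB; rewrite -[y]opprK subalgebraB // subalgebraN. Qed.
Lemma subalgebraM : {in B &, forall x y, x * y \in B}.
Proof. by case: sB => -[]. Qed.
Lemma subalgebraZ r : {in B, forall x, cst r * x \in B}.
Proof. by move=> x xB; apply: subalgebraM => //; case: sB. Qed.
Lemma subalgebra_sum (I : Type) (s : seq I) (P : pred I) (F : I -> A R) :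
  (forall i, P i -> F i \in B) -> \sum_(i <- s | P i) F i \in B.
Proof.
by move=> FB; elim/big_ind: _ => // [|y z]; [apply: subalgebra0|apply: subalgebraD].
Qed.
End Subalgebra.

Lemma base_change_subalgebra (R S : comNzRingType) (phi : {rmorphism R -> S})
    (B : pred (A R)) :
  is_subalgebra B -> is_subalgebra (Aplus_base_change phi B).
Proof.
move=> sB; have cstB r : cst r \in Aplus_base_change phi B.
  rewrite -[cst r]mulr1 -(rmorph1 (map phi)).
  by apply/base_changeZ/base_change_map/subalgebra1.
split=> //; split=> [|x y xB yB|x y xB yB].
- by have := cstB 1; rewrite rmorph1.
- by rewrite Aplus_oppE; apply: base_changeD => //; apply: base_changeZ.
- move: y yB; apply: base_change_ind => [|u v uB vB|s y yB].
  + by rewrite mulr0 base_change0.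
  + by rewrite mulrDr base_changeD.
  rewrite mulrCA; apply: base_changeZ; move: x xB.
  apply: base_change_ind => [|u v uB vB|r x xB].
  + by rewrite mul0r base_change0.
  + by rewrite mulrDl base_changeD.
  by rewrite -mulrA -rmorphM; apply/base_changeZ/base_change_map/subalgebraM.
Qed.

(** * Linear forms given by matrices *)

Section Functional.
Variables (R : comNzRingType) (g : nat).

(** The matrix [x] is read as a linear map from A to R^g whose row [y] is the image of the basis
    vector [y]. *)
Definition mxform (x : bidx -> 'I_g -> R) (l : 'I_g) (a : A R) : R :=
  \sum_y bcoef y a * x y l.

Lemma mxform0 x l : mxform x l 0 = 0.
Proof. by rewrite /mxform big1 // => y _; rewrite raddf0 mul0r. Qed.
Lemma mxformD x l a b : mxform x l (a + b) = mxform x l a + mxform x l b.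
Proof.
by rewrite -big_split; apply: eq_bigr => y _; rewrite bcoefD mulrDl.
Qed.
Lemma mxformZ x l r a : mxform x l (cst r * a) = r * mxform x l a.
Proof. by rewrite mulr_sumr; apply: eq_bigr => y _; rewrite bcoefZ mulrA. Qed.
Lemma mxformN x l a : mxform x l (- a) = - mxform x l a.
Proof. by rewrite Aplus_oppE mxformZ mulN1r. Qed.
Lemma mxformB x l a b : mxform x l (a - b) = mxform x l a - mxform x l b.
Proof. by rewrite mxformD mxformN. Qed.
Lemma mxform_sum x l (I : Type) (s : seq I) (P : pred I) (F : I -> A R) :
  mxform x l (\sum_(i <- s | P i) F i) = \sum_(i <- s | P i) mxform x l (F i).
Proof. by apply: big_morph => [a b|]; [apply: mxformD|apply: mxform0]. Qed.
Lemma mxform_bvec x l y : mxform x l (bvec c_gt0 R y) = x y l.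
Proof.
rewrite /mxform (bigD1 y) //= bcoef_bvec eqxx mul1r big1 ?addr0 // => z /negPf zy.
by rewrite bcoef_bvec eq_sym zy mul0r.
Qed.
End Functional.

Lemma mxform_map (R S : comNzRingType) (phi : {rmorphism R -> S}) g
    (x : bidx -> 'I_g -> R) l a :
  mxform (fun y l => phi (x y l)) l (map phi a) = phi (mxform x l a).
Proof.
by rewrite rmorph_sum; apply: eq_bigr => y _; rewrite bcoef_map rmorphM.
Qed.

Section FreeAway.
Variables (R : comNzRingType) (g : nat) (B : pred (A R)) (f : R).
Hypothesis sB : is_subalgebra B.

(** As A has a finite basis, denominators can be cleared by common powers of [f]: [mxform a] is f ^
    N times the coordinate map of (A / B)_f in the basis [v]. Only the power that kills the
    coordinates of [b] depends on [b]. *)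
Lemma free_away_data : quotient_free_away g B f ->
  exists (v : 'I_g -> A R) (a : bidx -> 'I_g -> R) (N M : nat),
    [/\ forall y, cst (f ^+ N) * y - \sum_i cst (mxform a i y) * v i \in B,
        forall b, b \in B -> exists K, forall l, f ^+ K * mxform a l b = 0
      & forall i l, f ^+ M * (mxform a l (v i) - f ^+ N * (i == l)%:R) = 0].
Proof.
case=> v [vspan vfree].
have [N] : exists N, forall y : bidx, exists a : 'I_g -> R,
    cst (f ^+ N) * bvec c_gt0 R y - \sum_i cst (a i) * v i \in B.
  apply: uniform_exponent => [y p q pq [a aB]|y]; last exact: vspan.
  exists (fun i => f ^+ (q - p) * a i).
  have := subalgebraZ sB (f ^+ (q - p)) aB.
  rewrite mulrBr mulrA -rmorphM -exprD subnK // mulr_sumr.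
  by under eq_bigr => i _ do rewrite mulrA -rmorphM.
move/choice => [a aB].
have span y : cst (f ^+ N) * y - \sum_i cst (mxform a i y) * v i \in B.
  rewrite [y in cst _ * y]Aplus_expand mulr_sumr.
  have -> : \sum_i cst (mxform a i y) * v i =
      \sum_z cst (bcoef z y) * \sum_i cst (a z i) * v i.
    under [RHS]eq_bigr => z _ do rewrite mulr_sumr.
    rewrite exchange_big; apply: eq_bigr => i _; rewrite rmorph_sum mulr_suml.
    by apply: eq_bigr => z _; rewrite rmorphM mulrA.
  rewrite -sumrB; apply: subalgebra_sum => // z _.
  by rewrite mulrCA -mulrBr subalgebraZ.
have lamB0 b : b \in B -> exists K, forall l, f ^+ K * mxform a l b = 0.
  move=> bB; apply: vfree.
  have := subalgebraB sB (subalgebraZ sB (f ^+ N) bB) (span b).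
  by rewrite opprB addrCA subrr addr0.
have lamv i : exists M, forall l, f ^+ M * (mxform a l (v i) - f ^+ N * (i == l)%:R) = 0.
  apply: vfree; have := subalgebraN sB (span (v i)).
  rewrite opprB; congr (is_true (_ \in B)).
  under [RHS]eq_bigr => l _ do rewrite rmorphB mulrBl.
  rewrite sumrB; congr (_ - _); rewrite (bigD1 i) //= eqxx mulr1.
  rewrite big1 ?addr0 // => l /negPf li.
  by rewrite eq_sym li mulr0 rmorph0 mul0r.
have [M MP] : exists M, forall i, forall l,
    f ^+ M * (mxform a l (v i) - f ^+ N * (i == l)%:R) = 0.
  apply: (@uniform_exponent _ (fun i M => forall l,
    f ^+ M * (mxform a l (v i) - f ^+ N * (i == l)%:R) = 0) _ lamv) => i p q pq vp l.
  by rewrite -(subnK pq) exprD -mulrA vp mulr0.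
by exists v, a, N, M.
Qed.

End FreeAway.

(** Independence is inherited because the coordinate forms witness it, and these can be pulled back
    along [phi] too. *)
Lemma base_change_free_away (R S : comNzRingType) (phi : {rmorphism R -> S}) g
    (B : pred (A R)) (f : R) :
  is_subalgebra B -> quotient_free_away g B f ->
  quotient_free_away g (Aplus_base_change phi B) (phi f).
Proof.
move=> sB /(free_away_data sB) [v [a [N [M [span lamB0 lamv]]]]].
exists (fun i => map phi (v i)); split.
  move=> y; exists N, (fun l => mxform (fun y l => phi (a y l)) l y).
  rewrite [y in cst _ * y]Aplus_expand mulr_sumr.
  have -> : \sum_i cst (mxform (fun y l => phi (a y l)) i y) * map phi (v i) =
      \sum_z cst (bcoef z y) * \sum_i cst (phi (a z i)) * map phi (v i).
    under [RHS]eq_bigr => z _ do rewrite mulr_sumr.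
    rewrite exchange_big; apply: eq_bigr => i _; rewrite rmorph_sum mulr_suml.
    by apply: eq_bigr => z _; rewrite rmorphM mulrA.
  rewrite -sumrB; apply: base_change_sum => z _.
  rewrite mulrCA -mulrBr; apply: base_changeZ.
  rewrite (_ : _ - _ = map phi (cst (f ^+ N) * bvec c_gt0 R z
      - \sum_i cst (mxform a i (bvec c_gt0 R z)) * v i)); first exact: base_change_map.
  rewrite rmorphB rmorphM /= Aplus_map_cst Aplus_map_bvec (rmorphXn phi) rmorph_sum.
  congr (_ - _); apply: eq_bigr => i _.
  by rewrite rmorphM /= Aplus_map_cst mxform_bvec.
move=> al alB.
have [K KP] : exists K, forall l, phi f ^+ K *
    mxform (fun y l => phi (a y l)) l (\sum_i cst (al i) * map phi (v i)) = 0.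
  move: (\sum_i _) alB; apply: base_change_ind.
  - by exists 0%N => l; rewrite mxform0 mulr0.
  - move=> y z [p yp] [q zq]; exists (p + q)%N => l.
    rewrite mxformD mulrDr exprD -!mulrA zq mulr0 addr0.
    by rewrite mulrCA yp mulr0.
  - move=> s b /lamB0 [K KP]; exists K => l.
    by rewrite mxformZ mxform_map mulrCA -rmorphXn -rmorphM /= KP rmorph0 mulr0.
exists (M + N + K)%N => l.
have E i : phi f ^+ M * (al i * mxform (fun y l => phi (a y l)) l (map phi (v i))) =
    phi f ^+ M * (al i * (phi f ^+ N * (i == l)%:R)).
  have /eqP := congr1 phi (lamv i l); rewrite rmorphM rmorphB mulrBr rmorph0.
  rewrite subr_eq0 => /eqP /(congr1 ( *%R (al i))).
  rewrite mxform_map rmorphXn rmorphM /= rmorphXn rmorph_nat => E.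
  by rewrite mulrCA E mulrCA.
have := congr1 ( *%R (phi f ^+ M)) (KP l).
rewrite mulr0 mulrCA mxform_sum.
under eq_bigr => i _ do rewrite mxformZ.
rewrite mulr_sumr (eq_bigr _ (fun i _ => E i)) (bigD1 l) //= eqxx mulr1.
rewrite big1 => [|i /negPf il]; last by rewrite il !mulr0.
rewrite addr0 => <-; rewrite !exprD; ring.
Qed.

Lemma base_change_Ter (R S : comNzRingType) (phi : {rmorphism R -> S}) g
    (B : pred (A R)) :
  Ter g B -> Ter g (Aplus_base_change phi B).
Proof.
move=> [sB [n [f [h [hf1 fB]]]]]; split; first exact: base_change_subalgebra.
exists n, (fun i => phi (f i)), (fun i => phi (h i)); split.
  by rewrite -(rmorph1 phi) -hf1 rmorph_sum; apply: eq_bigr => i _; rewrite rmorphM.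
by move=> i; apply: base_change_free_away.
Qed.

End Subalgebras.

(** * Subalgebras as kernels *)

Section Frames.
Variables (m : nat) (c : 'I_m -> nat) (c_gt0 : forall i, (0 < c i)%N).
Local Notation A R := (Aplus c_gt0 R).
Local Notation cst := (@Aplus_cst m c c_gt0 _).
Local Notation map := (Aplus_map (c_gt0 := c_gt0)).
Local Notation bidx := (bidx c).
Local Notation bvec R := (bvec c_gt0 R).
Variable g : nat.

Definition ker_sub (R : comNzRingType) (x : bidx -> 'I_g -> R) : pred (A R) :=
  [pred a | [forall l, mxform x l a == 0]].

Lemma ker_subP (R : comNzRingType) (x : bidx -> 'I_g -> R) a :
  reflect (forall l, mxform x l a = 0) (a \in ker_sub x).
Proof. exact: 'forall_eqP. Qed.

Definition framed (R : comNzRingType) (J : 'I_g -> bidx) (x : bidx -> 'I_g -> R) :=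
  forall i l, x (J i) l = (i == l)%:R.

(** For a framed [x], the projection of the basis vector [y] to the kernel along the span of t_J. *)
Definition rel_vec (R : comNzRingType) (J : 'I_g -> bidx) (x : bidx -> 'I_g -> R) y : A R :=
  bvec R y - \sum_i cst (x y i) * bvec R (J i).

Section Ring.
Variables (R : comNzRingType) (J : 'I_g -> bidx) (x : bidx -> 'I_g -> R).
Hypothesis xJ : framed J x.
Local Notation rel := (rel_vec J x).

Lemma mxform_frame (al : 'I_g -> R) l :
  mxform x l (\sum_i cst (al i) * bvec R (J i)) = al l.
Proof.
rewrite mxform_sum (bigD1 l) //= mxformZ mxform_bvec xJ eqxx mulr1 big1 ?addr0 //.
by move=> i /negPf il; rewrite mxformZ mxform_bvec xJ il mulr0.
Qed.

Lemma rel_vec_ker y : rel y \in ker_sub x.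
Proof. by apply/ker_subP => l; rewrite mxformB mxform_bvec mxform_frame subrr. Qed.

Lemma ker_subD a b : a \in ker_sub x -> b \in ker_sub x -> a + b \in ker_sub x.
Proof. by move=> /ker_subP a0 /ker_subP b0; apply/ker_subP => l; rewrite mxformD a0 b0 addr0. Qed.

Lemma ker_subZ r a : a \in ker_sub x -> cst r * a \in ker_sub x.
Proof. by move=> /ker_subP a0; apply/ker_subP => l; rewrite mxformZ a0 mulr0. Qed.

Lemma ker_sub0 : 0 \in ker_sub x.
Proof. by apply/ker_subP => l; rewrite mxform0. Qed.

Lemma frame_expand a :
  a - \sum_i cst (mxform x i a) * bvec R (J i) = \sum_y cst (bcoef y a) * rel y.
Proof.
rewrite {1}[a]Aplus_expand; under [in RHS]eq_bigr => y _ do rewrite mulrBr.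
rewrite sumrB; congr (_ - _).
under [in RHS]eq_bigr => y _ do rewrite mulr_sumr.
rewrite exchange_big; apply: eq_bigr => i _; rewrite rmorph_sum mulr_suml.
by apply: eq_bigr => y _; rewrite rmorphM mulrA.
Qed.

Lemma ker_expand a : a \in ker_sub x -> a = \sum_y cst (bcoef y a) * rel y.
Proof.
move=> /ker_subP a0; rewrite -frame_expand big1 ?subr0 // => i _.
by rewrite a0 rmorph0 mul0r.
Qed.

Lemma ker_sub_locally_free : quotient_locally_free g (ker_sub x).
Proof.
exists 1%N, (fun _ => 1), (fun _ => 1); rewrite big_ord1 mul1r; split=> // _.
exists (fun i => bvec R (J i)); split=> [a|al /ker_subP al0].
  exists 0%N, (fun i => mxform x i a); rewrite rmorph1 mul1r.
  by apply/ker_subP => l; rewrite mxformB mxform_frame subrr.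
by exists 0%N => i; rewrite mul1r -(mxform_frame al) al0.
Qed.

(** The vectors [rel] span the kernel, so closure under products becomes a finite system of
    polynomial equations in the entries of [x]: the equations of the chart. *)
Lemma ker_sub_subalgebra : 1 \in ker_sub x ->
  (forall y z l, mxform x l (rel y * rel z) = 0) -> is_subalgebra (ker_sub x).
Proof.
move=> x1 relM; split; last by move=> a; rewrite -[cst a]mulr1 ker_subZ.
split=> // [a b aK bK|a b aK bK].
  by rewrite Aplus_oppE ker_subD ?ker_subZ.
rewrite (ker_expand aK) (ker_expand bK) mulr_suml.
elim/big_ind: _ => [||y _]; [exact: ker_sub0|exact: ker_subD|].
rewrite mulr_sumr; elim/big_ind: _ => [||z _]; [exact: ker_sub0|exact: ker_subD|].
rewrite mulrACA -rmorphM ker_subZ //.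
by apply/ker_subP => l; apply: relM.
Qed.

Lemma framed_inj : injective J.
Proof.
move=> i j Jij; have := xJ i j; rewrite Jij xJ eqxx.
by case: eqVneq => // _ /eqP; rewrite oner_eq0.
Qed.

Lemma framed_None : 1 \in ker_sub x -> forall i, J i != None /\ x None i = 0.
Proof.
move=> /ker_subP x1 i; have := x1 i; rewrite -(bvec_None c_gt0) mxform_bvec => xi0.
split=> //; apply/eqP => JN; have := xJ i i; rewrite JN xi0 eqxx => /esym/eqP.
by rewrite oner_eq0.
Qed.

(** Coordinates on a chart are determined by the subalgebra, since the span of t_J is a complement
    of both kernels. *)
Lemma ker_sub_le (x' : bidx -> 'I_g -> R) : framed J x' ->
  {subset ker_sub x <= ker_sub x'} -> forall y l, x' y l = x y l.
Proof.
move=> x'J sub y l; have /sub/ker_subP/(_ l) := rel_vec_ker y.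
rewrite mxformB mxform_bvec mxform_sum (bigD1 l) //= mxformZ mxform_bvec x'J eqxx mulr1.
rewrite big1 ?addr0 => [/eqP|i /negPf il]; first by rewrite subr_eq0 => /eqP.
by rewrite mxformZ mxform_bvec x'J il mulr0.
Qed.

(** The frame splits the linear map [x], which is why its kernel commutes with every base change. *)
Lemma base_change_ker (S : comNzRingType) (phi : {rmorphism R -> S}) :
  Aplus_base_change phi (ker_sub x) = ker_sub (fun y l => phi (x y l)).
Proof.
pose x' y l := phi (x y l); have x'J : framed J x'.
  by move=> i l; rewrite /x' xJ rmorph_nat.
apply/funext => a; apply/idP/idP; last first.
  rewrite -[X in is_true X -> _]/(a \in ker_sub x') => /ker_subP a0.
  have : a - \sum_i cst (mxform x' i a) * bvec S (J i) \in Aplus_base_change phi (ker_sub x).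
    rewrite {1}[a]Aplus_expand.
    have -> : \sum_i cst (mxform x' i a) * bvec S (J i) = \sum_y cst (bcoef y a) *
        \sum_i cst (x' y i) * bvec S (J i).
      under [in RHS]eq_bigr => y _ do rewrite mulr_sumr.
      rewrite exchange_big; apply: eq_bigr => i _; rewrite rmorph_sum mulr_suml.
      by apply: eq_bigr => y _; rewrite rmorphM mulrA.
    rewrite -sumrB; apply: base_change_sum => y _; rewrite -mulrBr.
    rewrite (_ : _ - _ = map phi (rel y)); last first.
      rewrite rmorphB /= Aplus_map_bvec rmorph_sum; congr (_ - _).
      by apply: eq_bigr => i _; rewrite rmorphM /= Aplus_map_cst Aplus_map_bvec.
    exact/base_changeZ/base_change_map/rel_vec_ker.
  by rewrite big1 ?subr0 // => i _; rewrite a0 rmorph0 mul0r.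
move: a; apply: base_change_ind => [||s a /ker_subP a0].
- by apply/ker_subP => l; rewrite mxform0.
- move=> y z /ker_subP y0 /ker_subP z0; apply/ker_subP => l.
  by rewrite mxformD y0 z0 addr0.
by apply/ker_subP => l; rewrite mxformZ mxform_map a0 rmorph0 mulr0.
Qed.

End Ring.

(** In a module locally free of rank g, any g generators form a basis. Away from [f], let [W]
    express [v] through t_J and [Q] give the coordinates of t_J; then W Q is a power of [f], so det
    Q is a unit there and the adjugate of [Q] kills every relation. *)
Lemma frame_free (R : comNzRingType) (B : pred (A R)) (J : 'I_g -> bidx) :
  is_subalgebra B -> quotient_locally_free g B ->
  (forall y, exists s : 'I_g -> R, bvec R y - \sum_i cst (s i) * bvec R (J i) \in B) ->
  forall al : 'I_g -> R, \sum_i cst (al i) * bvec R (J i) \in B ->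
  forall i, al i = 0.
Proof.
move=> sB [n [f [h [hf1 fB]]]] /choice [s sJ] al alB i.
apply: (unit_ideal_annihilator hf1) => j; move: (f j) (fB j) => {hf1 fB h j} {}f.
case/(free_away_data sB) => v [a [N [M [_ lamB0 lamv]]]].
pose W := \matrix_(k < g, l < g) mxform s l (v k).
pose Q := \matrix_(k < g, l < g) a (J k) l.
have vW k : v k - \sum_l cst (W k l) * bvec R (J l) \in B.
  rewrite [v k in X in X - _]Aplus_expand.
  have -> : \sum_l cst (W k l) * bvec R (J l) = \sum_y cst (bcoef y (v k)) *
        \sum_l cst (s y l) * bvec R (J l).
    under [in RHS]eq_bigr => y _ do rewrite mulr_sumr.
    rewrite exchange_big; apply: eq_bigr => l _; rewrite mxE rmorph_sum mulr_suml.
    by apply: eq_bigr => y _; rewrite rmorphM mulrA.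
  rewrite -sumrB; apply: subalgebra_sum => // y _.
  by rewrite -mulrBr subalgebraZ.
have lamJ (be : 'I_g -> R) l : mxform a l (\sum_k cst (be k) * bvec R (J k)) =
    \sum_k be k * Q k l.
  by rewrite mxform_sum; apply: eq_bigr => k _; rewrite mxformZ mxform_bvec mxE.
have [K WQ] : exists K, f ^+ K *: (W *m Q) = f ^+ (K + N) *: 1%:M.
  have [K KP] : exists K, forall k l, f ^+ K * mxform a l
      (v k - \sum_l cst (W k l) * bvec R (J l)) = 0.
    apply: (@uniform_exponent _ (fun k K => forall l, f ^+ K * mxform a l
      (v k - \sum_l cst (W k l) * bvec R (J l)) = 0)) => [k p q pq kp l|k].
      by rewrite -(subnK pq) exprD -mulrA kp mulr0.
    exact: lamB0.
  exists (M + K)%N; apply/matrixP => k l; have := KP k l.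
  rewrite mxformB lamJ mulrBr => /eqP; rewrite subr_eq0 => /eqP E.
  rewrite !mxE exprD -mulrA -E mulrCA.
  have /eqP := lamv k l; rewrite mulrBr subr_eq0 => /eqP ->.
  rewrite !exprD; ring.
have [K' Qal] : exists K', forall l, f ^+ K' * \sum_k al k * Q k l = 0.
  by have [K' K'P] := lamB0 _ alB; exists K' => l; rewrite -lamJ K'P.
exists ((K + N) * g + K')%N.
have := congr1 determinant WQ; rewrite !detZ det_mulmx det1 mulr1 -!exprM => E.
rewrite exprD -E.
have : f ^+ K' *: ((\row_k al k) *m Q *m \adj Q) = 0.
  rewrite scalemxAl; set r := f ^+ K' *: _.
  have -> : r = 0 by apply/rowP => l; rewrite /r !mxE -[RHS](Qal l); congr (_ * _);
    apply: eq_bigr => k _; rewrite mxE.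
  by rewrite mul0mx.
rewrite -mulmxA mul_mx_adj mul_mx_scalar => /rowP /(_ i); rewrite !mxE => E0.
transitivity (f ^+ (K * g) * \det W * (f ^+ K' * (\det Q * al i))); first by ring.
by rewrite E0 mulr0.
Qed.

(** The rows of [x] are coordinates modulo B; their uniqueness, from [frame_free], gives both the
    frame condition and the inclusion of B in the kernel. *)
Lemma Ter_frame (R : comNzRingType) (B : pred (A R)) (J : 'I_g -> bidx) :
  Ter g B ->
  (forall y, exists s : 'I_g -> R, bvec R y - \sum_i cst (s i) * bvec R (J i) \in B) ->
  exists x : bidx -> 'I_g -> R, framed J x /\ B = ker_sub x.
Proof.
move=> [sB fB] spanJ; have free := frame_free sB fB spanJ.
have [x xB] := choice spanJ; exists x.
have xJ : framed J x.
  move=> i l; apply/esym/eqP; rewrite -subr_eq0; apply/eqP.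
  apply: (free (fun l => (i == l)%:R - x (J i) l)).
  have := xB (J i); congr (is_true (_ \in B)).
  under [RHS]eq_bigr => k _ do rewrite rmorphB mulrBl.
  rewrite sumrB; congr (_ - _); rewrite (bigD1 i) //= eqxx rmorph1 mul1r.
  by rewrite big1 ?addr0 // => k /negPf ki; rewrite eq_sym ki rmorph0 mul0r.
split=> //; apply/funext => a; apply/idP/idP => [aB|].
  apply/ker_subP; apply: free; rewrite -[\sum_i _](subKr a) frame_expand //.
  apply: subalgebraB => //; apply: subalgebra_sum => // y _.
  by apply: subalgebraZ => //; apply: xB.
move=> aK; rewrite -[X in is_true X]/(a \in B) (@ker_expand _ J x a aK).
apply: subalgebra_sum => // y _.
by apply: subalgebraZ => //; apply: xB.
Qed.

(* If v = b t for the monomial basis t, and t = a v modulo B, then b a is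
   invertible; expanding det (b a) over all choices of g monomials, some
   g x g minor of a is a unit. *)
Lemma free_away_frame (R : comNzRingType) (P : {pred R}) (B : pred (A R)) (f : R) :
  idealr_closed P -> prime_idealr_closed P ->
  (forall s, s \notin P -> exists t, s * t = 1) -> f \notin P ->
  is_subalgebra B -> quotient_free_away g B f ->
  exists J : 'I_g -> bidx,
    forall y, exists s : 'I_g -> R, bvec R y - \sum_i cst (s i) * bvec R (J i) \in B.
Proof.
move=> idealP primeP unitP fP sB /(free_away_data sB) [v [a [N [M [span _ lamv]]]]].
have fXP n : f ^+ n \notin P.
  elim: n => [|n /negPf IHn]; first by case: idealP.
  by apply/negP; rewrite exprS => /primeP; rewrite IHn (negPf fP).
have lamvE i l : mxform a l (v i) = f ^+ N * (i == l)%:R.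
  have [t ft] := unitP _ (fXP M); apply/eqP; rewrite -subr_eq0.
  have := congr1 ( *%R t) (lamv i l).
  by rewrite mulrA [t * _]mulrC ft mul1r mulr0 => ->.
have := det_sum_expand (fun i y => bcoef y (v i)) a.
have -> : \matrix_(i < g, l < g) \sum_y bcoef y (v i) * a y l = (f ^+ N)%:M.
  by apply/matrixP => i l; rewrite !mxE [LHS]lamvE mulr_natr.
rewrite det_scalar -exprM => fE.
have [/existsP [J JP]|] := boolP [exists J : {ffun 'I_g -> bidx},
    \det (\matrix_(i < g, l < g) a (J i) l) \notin P]; last first.
  rewrite negb_exists => /forallP allP; case/negP: (fXP (N * g)%N); rewrite fE.
  case: idealP => P0 _ PD.
  elim/big_ind: _ => // [x y xP yP|J _]; first by rewrite -[x]mul1r PD.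
  by rewrite -[X in X \in _]addr0 PD //; have := allP J; rewrite negbK.
exists J => y; set Q := \matrix_(i, l) _ in JP.
have [d Qd] := unitP _ JP; have [t ft] := unitP _ (fXP N).
have spanJ i : cst (f ^+ N) * bvec R (J i) - \sum_l cst (Q i l) * v l \in B.
  rewrite (eq_bigr (fun l => cst (mxform a l (bvec R (J i))) * v l)); first exact: span.
  by move=> l _; rewrite mxform_bvec mxE.
(* Cramer's rule: the adjugate of [Q] solves the relations [spanJ] for [v]. *)
have spanv k : cst (\det Q) * v k - \sum_i cst (\adj Q k i * f ^+ N) * bvec R (J i) \in B.
  have -> : cst (\det Q) * v k - \sum_i cst (\adj Q k i * f ^+ N) * bvec R (J i) =
    - \sum_i cst (\adj Q k i) * (cst (f ^+ N) * bvec R (J i) - \sum_l cst (Q i l) * v l).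
    under [in RHS]eq_bigr => i _ do rewrite mulrBr mulr_sumr mulrA -rmorphM.
    rewrite sumrB opprB; congr (_ - _); rewrite exchange_big /=.
    rewrite (bigD1 k) //= [X in _ + X]big1 => [|l lk].
      rewrite addr0; under eq_bigr => i _ do rewrite mulrA -rmorphM.
      rewrite -mulr_suml -rmorph_sum; congr (cst _ * _).
      have := congr1 (fun X : 'M_g => X k k) (mul_adj_mx Q).
      by rewrite !mxE eqxx mulr1n => <-.
    under eq_bigr => i _ do rewrite mulrA -rmorphM.
    rewrite -mulr_suml -rmorph_sum.
    have := congr1 (fun X : 'M_g => X k l) (mul_adj_mx Q).
    by rewrite !mxE eq_sym (negPf lk) mulr0n => ->; rewrite rmorph0 mul0r.
  rewrite Aplus_oppE; apply: subalgebraZ => //; apply: subalgebra_sum => // i _.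
  exact: subalgebraZ.
exists (fun i => t * d * \sum_k a y k * (\adj Q k i * f ^+ N)).
(* Here [t] inverts f ^ N and [d] inverts det Q: the first summand reduces the basis vector [y] to
   the [v k], the second replaces these by t_J. *)
have -> : bvec R y - \sum_i cst (t * d * \sum_k a y k * (\adj Q k i * f ^+ N)) *
     bvec R (J i) =
   cst t * (cst (f ^+ N) * bvec R y - \sum_k cst (mxform a k (bvec R y)) * v k) +
   \sum_k cst (t * d * a y k) *
     (cst (\det Q) * v k - \sum_i cst (\adj Q k i * f ^+ N) * bvec R (J i)).
  rewrite mulrBr mulrA -rmorphM (mulrC t (f ^+ N)) ft rmorph1 mul1r -addrA; congr (_ + _).
  rewrite [X in _ = _ + X](_ : _ = \sum_k cst (t * d * a y k * \det Q) * v k -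
      \sum_k cst (t * d * a y k) * \sum_i cst (\adj Q k i * f ^+ N) * bvec R (J i));
    last by rewrite -sumrB; apply: eq_bigr => k _; rewrite mulrBr mulrA -rmorphM.
  rewrite addrA mulr_sumr.
  have -> : \sum_k cst (t * d * a y k * \det Q) * v k =
      \sum_k cst t * (cst (mxform a k (bvec R y)) * v k).
    apply: eq_bigr => k _; rewrite mxform_bvec mulrA -rmorphM; congr (cst _ * _).
    transitivity (t * a y k * (\det Q * d)); first by ring.
    by rewrite Qd mulr1.
  rewrite addNr sub0r; congr (- _).
  under [in RHS]eq_bigr => k _ do rewrite mulr_sumr.
  rewrite exchange_big /=; apply: eq_bigr => i _.
  rewrite mulr_sumr rmorph_sum mulr_suml; apply: eq_bigr => k _.
  by rewrite [RHS]mulrA -rmorphM !mulrA.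
apply: subalgebraD => //; first by apply: subalgebraZ => //; apply: span.
by apply: subalgebra_sum => // k _; apply: subalgebraZ => //; apply: spanv.
Qed.

(** Since 1 lies in B, the monomials other than 1 span A / B. If there were fewer than g of them,
    every minor in the expansion would have a zero row or two equal rows. *)
Lemma Ter_rank_le (R : comNzRingType) (B : pred (A R)) : Ter g B -> (g < #|{: bidx}|)%N.
Proof.
move=> [sB [n [f [h [hf1 fB]]]]]; rewrite ltnNge; apply/negP => gn.
suff /eqP : (1 : R) = 0 by rewrite oner_eq0.
apply: (unit_ideal_annihilator hf1) => j; move: (f j) (fB j) => {hf1 fB h j} {}f.
case/(free_away_data sB) => v [a [N [M [_ lamB0 lamv]]]].
have [K KP] := lamB0 _ (subalgebra1 sB).
(* Scaled so that the row of [None] vanishes and the relations [lamv] hold exactly. *)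
pose a' y l := f ^+ (K + M) * a y l.
exists ((K + M + N) * g)%N; rewrite mulr1.
have := det_sum_expand (fun i y => bcoef y (v i)) a'.
have -> : \matrix_(i < g, l < g) \sum_y bcoef y (v i) * a' y l = (f ^+ (K + M + N))%:M.
  apply/matrixP => i l; rewrite !mxE -mulr_natr.
  transitivity (f ^+ (K + M) * mxform a l (v i)).
    by rewrite mulr_sumr; apply: eq_bigr => y _; rewrite mulrCA.
  have /eqP := lamv i l; rewrite mulrBr subr_eq0 => /eqP E.
  by rewrite exprD -mulrA E !exprD; ring.
rewrite det_scalar -exprM => ->; apply: big1 => J _.
suff -> : \det (\matrix_(i < g, l < g) a' (J i) l) = 0 by rewrite mulr0.
have [/existsP [i /eqP Ji]|] := boolP [exists i, J i == None].
  rewrite (expand_det_row _ i) big1 // => l _; rewrite mxE Ji /a'.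
  by rewrite -[a None l](mxform_bvec c_gt0) bvec_None addnC exprD -mulrA KP mulr0 mul0r.
rewrite negb_exists => /forallP JN.
have /injectivePn [i [i' ii' Jii']] : ~~ injectiveb J.
  apply: contraL gn => /injectiveP J_inj; rewrite -ltnNge.
  rewrite -[X in (X < _)%N]card_ord -(card_codom J_inj); apply: proper_card.
  apply/properP; split; first exact: subset_predT.
  exists None => //; apply/codomP => -[i Ji].
  by have := JN i; rewrite -Ji eqxx.
by apply: (determinant_alternate ii') => l; rewrite !mxE Jii'.
Qed.

End Frames.
Arguments ker_sub {m c} c_gt0 {g R} x.
Arguments rel_vec {m c} c_gt0 {g R} J x y.

(** * Charts of the territory *)

Section Chart.
Variables (m : nat) (c : 'I_m -> nat) (c_gt0 : forall i, (0 < c i)%N).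
Local Notation A R := (Aplus c_gt0 R).
Local Notation cst := (@Aplus_cst m c c_gt0 _).
Local Notation map := (Aplus_map (c_gt0 := c_gt0)).
Local Notation bidx := (bidx c).
Local Notation bvec R := (bvec c_gt0 R).
Variables (g : nat) (J : 'I_g -> bidx).

Section Spanned.
Variables (R : comNzRingType) (B : pred (A R)).
Hypothesis sB : is_subalgebra B.

Definition spanned_mod (a : A R) : Prop :=
  exists s : 'I_g -> R, a - \sum_i cst (s i) * bvec R (J i) \in B.

Lemma spanned_modD a b : spanned_mod a -> spanned_mod b -> spanned_mod (a + b).
Proof.
move=> [s sa] [t tb]; exists (fun i => s i + t i).
under eq_bigr => i _ do rewrite rmorphD mulrDl.
by rewrite big_split opprD addrACA subalgebraD.
Qed.

Lemma spanned_modZ r a : spanned_mod a -> spanned_mod (cst r * a).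
Proof.
move=> [s sa]; exists (fun i => r * s i).
under eq_bigr => i _ do rewrite rmorphM -mulrA.
by rewrite -mulr_sumr -mulrBr subalgebraZ.
Qed.

Lemma spanned_mod_mem a : a \in B -> spanned_mod a.
Proof.
by exists (fun _ => 0); rewrite big1 ?subr0 // => i _; rewrite rmorph0 mul0r.
Qed.

Lemma spanned_mod_sum (I : Type) (s : seq I) (P : pred I) (F : I -> A R) :
  (forall i, P i -> spanned_mod (F i)) -> spanned_mod (\sum_(i <- s | P i) F i).
Proof.
move=> FB; elim/big_ind: _ => // [|y z]; last exact: spanned_modD.
by apply: spanned_mod_mem; apply: subalgebra0.
Qed.

Lemma spanned_mod_bvec i : spanned_mod (bvec R (J i)).
Proof.
exists (fun l => (l == i)%:R); rewrite (bigD1 i) //= eqxx rmorph1 mul1r.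
rewrite big1 ?addr0 ?subrr ?subalgebra0 // => l /negPf ->.
by rewrite rmorph0 mul0r.
Qed.
End Spanned.

Section SpanIdeal.
Variables (S T : comNzRingType) (rho : {rmorphism S -> T}) (B : pred (A S)).
Hypothesis sB : is_subalgebra B.

(* The annihilator of A / (B + span J); its vanishing locus is where the
   vectors of J fail to span A / B. *)
Definition span_ideal (e : S) : Prop :=
  forall y, spanned_mod B (cst e * bvec S y).

Lemma spanned_of_unit_ideal : generates_unit_ideal rho span_ideal ->
  forall y, spanned_mod (Aplus_base_change rho B) (bvec T y).
Proof.
have sBC := base_change_subalgebra rho sB.
move=> [n [e [h [eE he1]]]] y.
have -> : bvec T y = \sum_i cst (h i) * map rho (cst (e i) * bvec S y).
  rewrite -[LHS]mul1r -(rmorph1 (@Aplus_cst m c c_gt0 T)) -he1 rmorph_sum mulr_suml.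
  apply: eq_bigr => i _.
  by rewrite rmorphM [in RHS]rmorphM /= Aplus_map_cst Aplus_map_bvec mulrA.
apply: spanned_mod_sum => // i _; apply: spanned_modZ => //.
have [s sP] := eE i y; exists (fun i => rho (s i)).
rewrite (_ : _ - _ = map rho (cst (e i) * bvec S y - \sum_i cst (s i) * bvec S (J i))).
  exact: base_change_map.
rewrite rmorphB rmorph_sum; congr (_ - _); apply: eq_bigr => l _.
by rewrite [RHS]rmorphM /= Aplus_map_cst Aplus_map_bvec.
Qed.

(** Annihilators need not commute with base change, but the maximal minors of a matrix of relations
    do, and Cramer's rule puts them in [span_ideal]. So the argument runs through a Fitting
    ideal. *)
Lemma unit_ideal_of_spanned :
  (forall y, spanned_mod (Aplus_base_change rho B) (bvec T y)) ->
  generates_unit_ideal rho span_ideal.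
Proof.
move=> /choice [s sP].
pose U := {n : nat & (('I_n -> T) * ('I_n -> A S))%type}.
have /choice [F FP] y : exists u : U, (forall j, (tagged u).2 j \in B) /\
    bvec T y - \sum_i cst (s y i) * bvec T (J i) =
    \sum_j cst ((tagged u).1 j) * map rho ((tagged u).2 j).
  have /asboolP [n [t [b [bB E]]]] := sP y.
  by exists (Tagged (fun n => ('I_n -> T) * ('I_n -> A S))%type (t, b)).
(* Indexes finitely many relations over S: the elements of B used to express some basis vector over
   T, and the vectors of t_J. *)
pose L : finType := ({y : bidx & 'I_(tag (F y))} + 'I_g)%type.
pose be (l : L) : A S := match l with
  | inl p => (tagged (F (tag p))).2 (tagged p) | inr i => bvec S (J i) end.
(* The indicator keeps only the block of relations that belongs to [y]. *)
pose ta (y : bidx) (l : L) : T := match l with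
  | inl p => (tag p == y)%:R * (tagged (F (tag p))).1 (tagged p)
  | inr i => s y i end.
have spanbe l : spanned_mod B (be l).
  case: l => [[y j]|i] /=; last exact: spanned_mod_bvec.
  by apply: spanned_mod_mem => //; case: (FP y).
have tabe y z : \sum_l ta y l * rho (bcoef z (be l)) = (y == z)%:R.
  rewrite big_sumType /= -(bcoef_bvec c_gt0).
  have [_ /eqP] := FP y; rewrite subr_eq => /eqP ->.
  rewrite bcoefD !bcoef_sum; congr (_ + _); last first.
    by apply: eq_bigr => i _; rewrite bcoefZ !bcoef_bvec rmorph_nat.
  rewrite -(sig_big_dep xpredT (fun _ => xpredT) (fun w j => (w == y)%:R *
     (tagged (F w)).1 j * rho (bcoef z ((tagged (F w)).2 j)))) /=.
  rewrite (bigD1 y) //= [X in _ + X]big1 => [|w /negPf wy]; last first.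
    by rewrite big1 // => j _; rewrite wy !mul0r.
  rewrite addr0; apply: eq_bigr => j _.
  by rewrite eqxx mul1r bcoefZ bcoef_map.
pose n := #|{: bidx}|.
pose Q (f : {ffun 'I_n -> L}) := \matrix_(i < n, l < n) bcoef (enum_val l) (be (f i)).
have := det_sum_expand (fun i l => ta (enum_val i) l)
  (fun l (i : 'I_n) => rho (bcoef (enum_val i) (be l))).
have -> : \matrix_(i < n, l < n) \sum_y ta (enum_val i) y *
    rho (bcoef (enum_val l) (be y)) = 1%:M.
  by apply/matrixP => i l; rewrite !mxE tabe (inj_eq enum_val_inj).
rewrite det1 => det1E.
exists #|{: {ffun 'I_n -> L}}|, (fun i => \det (Q (enum_val i))).
exists (fun i => \prod_l ta (enum_val l) ((enum_val i : {ffun 'I_n -> L}) l)); split.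
  move=> i y; move: (enum_val i) => f.
  have -> : cst (\det (Q f)) * bvec S y =
      \sum_l cst (\adj (Q f) (enum_rank y) l) * be (f l).
    apply: bcoef_inj => z /=; rewrite bcoefZ bcoef_bvec bcoef_sum.
    have := congr1 (fun X : 'M_n => X (enum_rank y) (enum_rank z)) (mul_adj_mx (Q f)).
    rewrite !mxE (inj_eq enum_rank_inj) mulr_natr => <-.
    by apply: eq_bigr => l _; rewrite bcoefZ [Q f _ _]mxE enum_rankK.
  apply: spanned_mod_sum => // l _; apply: spanned_modZ => //.
rewrite [RHS]det1E [RHS](reindex _ (onW_bij _ (@enum_val_bij _))) /=.
apply: eq_bigr => i _; congr (_ * _); rewrite -det_map_mx; congr (\det _).
by apply/matrixP => a b; rewrite !mxE.
Qed.
End SpanIdeal.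

Hypotheses (J_inj : injective J) (J_None : forall i, J i != None).

Definition chart_row : {set bidx} := [set y | (y != None) && (y \notin codom J)].
Definition chart_idx : finType := ({y | y \in chart_row} * 'I_g)%type.

Lemma card_chart_idx : #|{: chart_idx}| = ((#|{: bidx}|.-1 - g) * g)%N.
Proof.
rewrite card_prod card_ord card_sig; congr (_ * _)%N.
rewrite -(card_ord g) -[in X in (_ - X)%N](card_codom J_inj) -subn1 -subnDA.
have JN : None \notin codom J.
  by apply/negP => /codomP [i Ji]; have := J_None i; rewrite -Ji eqxx.
have -> : (1 + #|codom J|)%N = #|None |: [set y in codom J]|.
  by rewrite cardsU1 inE JN cardsE.
rewrite -[X in (X - _)%N]cardsT -cardsDS ?subsetT // setTD -[in LHS]cardsE.
apply: eq_card => y; rewrite !inE negb_or; congr andb; by rewrite unfold_in.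
Qed.

(** The remaining rows are forced: the frame gives identity rows on t_J, and 1 in the kernel gives a
    zero row at [None], where [y == J l] is false. *)
Definition chart_mx (T : comNzRingType) (pt : chart_idx -> T) (y : bidx) (l : 'I_g) : T :=
  if @insub bidx (fun y => y \in chart_row) _ y is Some d then pt (d, l) else (y == J l)%:R.

Lemma chart_mx_row (T : comNzRingType) (pt : chart_idx -> T) (d : chart_idx) :
  chart_mx pt (val d.1) d.2 = pt d.
Proof. by rewrite /chart_mx valK; case: d. Qed.

Lemma chart_mx_framed (T : comNzRingType) (pt : chart_idx -> T) : framed J (chart_mx pt).
Proof.
move=> i l; rewrite /chart_mx insubN ?(inj_eq J_inj) //.
by rewrite inE codom_f andbF.
Qed.

Lemma chart_mx_None (T : comNzRingType) (pt : chart_idx -> T) l :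
  chart_mx pt None l = 0.
Proof.
rewrite /chart_mx insubN ?inE // eq_sym.
by rewrite (negPf (J_None l)).
Qed.

Lemma chart_mx1 (T : comNzRingType) (pt : chart_idx -> T) :
  1 \in ker_sub c_gt0 (chart_mx pt).
Proof.
by apply/ker_subP => l; rewrite -(bvec_None c_gt0) mxform_bvec chart_mx_None.
Qed.

Lemma chart_mx_surj (T : comNzRingType) (x : bidx -> 'I_g -> T) :
  framed J x -> (forall l, x None l = 0) ->
  x = chart_mx (fun d => x (val d.1) d.2).
Proof.
move=> xJ x0; apply/funext => y; apply/funext => l; rewrite /chart_mx.
case: insubP => [d _ <- //|]; rewrite inE negb_and !negbK => /orP [/eqP ->|].
  by rewrite x0 eq_sym (negPf (J_None l)).
by move=> /codomP [i ->]; rewrite xJ (inj_eq J_inj).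
Qed.

Lemma chart_mx_map (S T : comNzRingType) (phi : {rmorphism S -> T}) (pt : chart_idx -> S) :
  (fun y l => phi (chart_mx pt y l)) = chart_mx (fun d => phi (pt d)).
Proof.
apply/funext => y; apply/funext => l; rewrite /chart_mx.
by case: insubP => // _; rewrite rmorph_nat.
Qed.

Definition chart_point (T : comNzRingType) (pt : chart_idx -> T) : Prop :=
  is_subalgebra (ker_sub c_gt0 (chart_mx pt)).

(** The equations of the chart are natural in the ring, so they can be tested at points or after an
    injection. *)
Lemma mxform_rel_map (S T : comNzRingType) (phi : {rmorphism S -> T})
    (x : bidx -> 'I_g -> S) l y z :
  phi (mxform x l (rel_vec c_gt0 J x y * rel_vec c_gt0 J x z)) =
  mxform (fun y l => phi (x y l)) l
    (rel_vec c_gt0 J (fun y l => phi (x y l)) y *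
     rel_vec c_gt0 J (fun y l => phi (x y l)) z).
Proof.
have relE w : rel_vec c_gt0 J (fun y l => phi (x y l)) w = map phi (rel_vec c_gt0 J x w).
  rewrite [RHS]rmorphB /= Aplus_map_bvec rmorph_sum; congr (_ - _).
  by apply: eq_bigr => i _; rewrite rmorphM /= Aplus_map_cst Aplus_map_bvec.
by rewrite !relE -rmorphM mxform_map.
Qed.

Variable k : fieldType.

(* The ideal of the chart consists of all polynomials that vanish at every
   chart point; a point is needed only for this ideal to be proper. *)
Lemma exists_chart (T0 : comAlgType k) (pt0 : chart_idx -> T0) : chart_point pt0 ->
  exists (S : comAlgType k) (pt : chart_idx -> S),
    [/\ chart_point pt,
        forall (T : comAlgType k) (pt' : chart_idx -> T), chart_point pt' ->
          exists phi : {lrmorphism S -> T}, forall d, phi (pt d) = pt' d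
      & forall (T : comAlgType k) (phi psi : {lrmorphism S -> T}),
          (forall d, phi (pt d) = psi (pt d)) -> phi =1 psi].
Proof.
move=> pt0P; pose P := {mpoly k[#|{: chart_idx}|]}.
pose X (d : chart_idx) : P := 'X_(enum_rank d).
pose I : {pred P} := fun p => `[< forall (T : comAlgType k) (f : {lrmorphism P -> T}),
  chart_point (fun d => f (X d)) -> f p = 0 >].
have evalP (T : comAlgType k) (pt : chart_idx -> T) :
    exists f : {lrmorphism P -> T}, (fun d => f (X d)) = pt.
  have [f fE] := mpoly_eval (fun i : 'I_#|{: chart_idx}| => pt (enum_val i)).
  by exists f; apply/funext => d; rewrite fE enum_rankK.
have idealI : idealr_closed I.
  split; first by apply/asboolP => T f _; rewrite rmorph0.
    apply/negP => /asboolP I1; have [f fE] := evalP _ pt0.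
    by have := I1 T0 f; rewrite fE rmorph1 => /(_ pt0P)/eqP; rewrite oner_eq0.
  move=> a u v /asboolP uI /asboolP vI; apply/asboolP => T f fP.
  by rewrite rmorphD rmorphM /= (uI T f fP) (vI T f fP) mulr0 addr0.
have [S [p [p0 psurj]]] := exists_quotient idealI.
exists S, (fun d => p (X d)); split.
- rewrite /chart_point; apply: (@ker_sub_subalgebra _ _ c_gt0 g S J); first exact: chart_mx1.
  (* Each equation holds at every chart point, hence belongs to [I]. *)
  move=> y z l; rewrite -chart_mx_map -mxform_rel_map; apply/p0/asboolP => T f fP.
  rewrite mxform_rel_map chart_mx_map; move: l; apply/ker_subP.
  by apply: subalgebraM => //; apply: rel_vec_ker; apply: chart_mx_framed.
- move=> T pt' pt'P; have [f fE] := evalP _ pt'.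
  have [|phi phiE] := quotient_lift psurj (f := f).
    by move=> x /p0 /asboolP /(_ T f); rewrite fE; apply.
  by exists phi => d; rewrite phiE -fE.
- move=> T phi psi E x; have [q ->] := psurj x.
  have [|||f1 f1E] := @lrmorphismP k P T (phi \o p).
  + by move=> u v; rewrite /= !rmorphB.
  + by split=> [|u v]; rewrite /= ?rmorph1 ?rmorphM.
  + by move=> a u; rewrite /= !linearZ.
  have [|||f2 f2E] := @lrmorphismP k P T (psi \o p).
  + by move=> u v; rewrite /= !rmorphB.
  + by split=> [|u v]; rewrite /= ?rmorph1 ?rmorphM.
  + by move=> a u; rewrite /= !linearZ.
  have := @mpoly_lrmorphism_eq _ _ _ f1 f2.
  move=> /(_ _ q); rewrite f1E f2E; apply => i.
  by rewrite f1E f2E /= -[i]enum_valK; apply: E.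
Qed.

(** The chart meets the point B exactly where t_J spans A / B, the complement of V([span_ideal B]):
    there [Ter_frame] turns the pullback of B into a matrix, that is, into a point of the chart. *)
Lemma chart_affine_open (S : comAlgType k) (pt : chart_idx -> S) :
  chart_point pt ->
  (forall (T : comAlgType k) (pt' : chart_idx -> T), chart_point pt' ->
     exists phi : {lrmorphism S -> T}, forall d, phi (pt d) = pt' d) ->
  (forall (T : comAlgType k) (phi psi : {lrmorphism S -> T}),
     (forall d, phi (pt d) = psi (pt d)) -> phi =1 psi) ->
  @affine_open k (Ter_over c_gt0 g k) S (ker_sub c_gt0 (chart_mx pt)).
Proof.
move=> ptP ptU ptI; have fr (T : comNzRingType) := @chart_mx_framed T.
have BCE (T : comAlgType k) (phi : {lrmorphism S -> T}) :
    Aplus_base_change phi (ker_sub c_gt0 (chart_mx pt)) =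
    ker_sub c_gt0 (chart_mx (fun d => phi (pt d))).
  by rewrite (@base_change_ker _ _ c_gt0 g S J _ (fr _ _)) chart_mx_map.
split=> /=.
- by split=> //; apply: (@ker_sub_locally_free _ _ c_gt0 g S J).
- move=> T phi psi; rewrite !BCE => E; apply: ptI => d.
  rewrite -(chart_mx_row (fun d => phi (pt d))) -(chart_mx_row (fun d => psi (pt d))).
  by apply: (@ker_sub_le _ _ c_gt0 g T J _ (fr _ _) _ (fr _ _)) => a; rewrite E.
move=> R B [sB fB]; exists (span_ideal B) => T rho; split.
  move=> [phi phiE]; apply: unit_ideal_of_spanned => // y.
  rewrite -phiE BCE; eexists; exact: (rel_vec_ker c_gt0 (fr _ _) y).
move=> /(spanned_of_unit_ideal sB) spanJ.
have TB := base_change_Ter rho (conj sB fB).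
have [x [xJ BE]] := Ter_frame TB spanJ.
have sBC := base_change_subalgebra rho sB.
have := subalgebra1 sBC; rewrite BE => x1.
have xE := chart_mx_surj xJ (fun l => (@framed_None _ _ c_gt0 g T J x xJ x1 l).2).
have [|phi phiE] := ptU T (fun d => x (val d.1) d.2).
  by rewrite /chart_point -xE -BE.
exists phi; rewrite BCE [in RHS]xE; congr (ker_sub _ (chart_mx _)).
exact/funext.
Qed.

End Chart.

(** * The upper bound *)

Section PrimeExtension.
Variables (k : fieldType) (R L : comAlgType k) (f : {lrmorphism R -> L}).
Variables (P Q : {pred R}).
Hypotheses (idealP : idealr_closed P) (primeP : prime_idealr_closed P).
Hypotheses (idealQ : idealr_closed Q) (primeQ : prime_idealr_closed Q).
Hypotheses (fsurj : forall y, exists a s, s \notin P /\ f s * y = f a)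
  (fker : forall a, f a = 0 -> exists2 s, s \notin P & s * a = 0).
Hypothesis QP : {subset Q <= P}.

Definition prime_extension : {pred L} :=
  fun y => `[< exists a s, [/\ s \notin P, f s * y = f a & a \in Q] >].

Let notPM x y : x \notin P -> y \notin P -> x * y \notin P.
Proof. by move=> /negPf xP /negPf yP; apply/negP => /primeP; rewrite xP yP. Qed.

Let QM a x : x \in Q -> a * x \in Q.
Proof. by case: idealQ => Q0 _ QD xQ; rewrite -[_ * _]addr0 QD. Qed.

Let QMl a x : a \notin P -> a * x \in Q -> x \in Q.
Proof.
by move=> aP /primeQ /orP [/QP|//]; rewrite (negPf aP).
Qed.

Let QB x y : x - y \in Q -> y \in Q -> x \in Q.
Proof.
by case: idealQ => _ _ QD xyQ yQ; rewrite -(subrK y x) -[x - y]mul1r QD.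
Qed.

(** Two fractions equal to [y] agree after multiplication by elements outside P, and these can be
    cancelled modulo the prime Q contained in P. *)
Lemma mem_prime_extension s y a :
  s \notin P -> f s * y = f a -> (y \in prime_extension) = (a \in Q).
Proof.
move=> sP E; apply/asboolP/idP => [[a' [s' [s'P E' a'Q]]]|aQ]; last by exists a, s.
have [|t tP tE] := @fker (s' * a - s * a').
  by rewrite rmorphB !rmorphM /= -E -E'; ring.
apply: (QMl s'P); apply: QB (QM s a'Q); apply: (QMl tP).
by rewrite tE; case: idealQ.
Qed.

Lemma mem_prime_extension_f a : (f a \in prime_extension) = (a \in Q).
Proof.
apply: (mem_prime_extension (s := 1)); last by rewrite rmorph1 mul1r.
by case: idealP.
Qed.

Lemma prime_extension_ideal : idealr_closed prime_extension.
Proof.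
case: idealQ => Q0 Q1 QD; split.
- by rewrite -(rmorph0 f) mem_prime_extension_f.
- by rewrite -(rmorph1 f) mem_prime_extension_f.
move=> z x y xQ yQ.
have [[a [s [sP sE]]] [b [t [tP tE]]]] := (fsurj x, fsurj y).
have [d [r [rP rE]]] := fsurj z.
rewrite (@mem_prime_extension (r * s * t) _ (d * t * a + r * s * b)).
- by rewrite QD ?QM // -?(mem_prime_extension sP sE) -?(mem_prime_extension tP tE).
- by rewrite !notPM.
by rewrite rmorphD !rmorphM /= -rE -sE -tE; ring.
Qed.

Lemma prime_extension_prime : prime_idealr_closed prime_extension.
Proof.
move=> x y; have [[a [s [sP sE]]] [b [t [tP tE]]]] := (fsurj x, fsurj y).
rewrite (@mem_prime_extension (s * t) _ (a * b)); last 2 first.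
- exact: notPM.
- by rewrite !rmorphM /= -sE -tE; ring.
by rewrite (mem_prime_extension sP sE) (mem_prime_extension tP tE); apply: primeQ.
Qed.

End PrimeExtension.

(** * Chains of primes in affine open subschemes *)

Section UpperBound.
Variables (m : nat) (c : 'I_m -> nat) (c_gt0 : forall i, (0 < c i)%N) (g : nat).
Variable k : fieldType.
Local Notation A R := (Aplus c_gt0 R).
Local Notation bidx := (bidx c).

(** Equations among the coordinates can be checked in a larger ring, so a subalgebra descends to any
    subring that contains its coordinates. *)
Lemma ker_sub_subalgebra_inj (S T : comNzRingType) (f : {rmorphism S -> T}) J
    (x : bidx -> 'I_g -> S) :
  injective f -> framed J x -> 1 \in ker_sub c_gt0 x ->
  is_subalgebra (ker_sub c_gt0 (fun y l => f (x y l))) ->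
  is_subalgebra (ker_sub c_gt0 x).
Proof.
move=> f_inj xJ x1 sK; apply: (@ker_sub_subalgebra _ _ c_gt0 g S J) => // y z l.
apply: f_inj; rewrite (@mxform_rel_map m c c_gt0 g J) rmorph0; move: l; apply/ker_subP.
have fxJ : framed J (fun y l => f (x y l)) by move=> i l; rewrite xJ rmorph_nat.
by apply: subalgebraM => //; apply: rel_vec_ker.
Qed.

Lemma affine_open_chain_le (R : comAlgType k) (u : pred (A R)) e (P : nat -> {pred R}) :
  @affine_open k (Ter_over c_gt0 g k) R u -> prime_chain e P ->
  (e <= (#|{: bidx}|.-1 - g) * g)%N.
Proof.
move=> [/= uTer umono uopen] [primesP stepsP].
have [idealPe primePe] := primesP e (leqnn e).
have subP l : (l <= e)%N -> {subset P l <= P e}.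
  move=> le; suff H n : (l <= n <= e)%N -> {subset P l <= P n}.
    by apply: H; rewrite le leqnn.
  elim: n => [|n IHn]; first by rewrite leqn0 => /andP [/eqP -> _].
  rewrite leq_eqVlt ltnS => /andP [/orP [/eqP <- _ //|ln ne x xl]].
  have [subn _] := stepsP n ne; apply/subn/IHn => //.
  by rewrite ln ltnW.
(* Over the local ring [L] a single frame is enough, and the chain survives because all its primes
   lie in P e. *)
have [L [f [funit fsurj fker]]] := exists_localization idealPe primePe.
pose Q l := prime_extension f (P e) (P l).
have idealQ l : (l <= e)%N -> idealr_closed (Q l).
  move=> le; have [idl prl] := primesP l le.
  exact: (prime_extension_ideal idealPe primePe idl prl fsurj fker (subP l le)).
have primeQ l : (l <= e)%N -> prime_idealr_closed (Q l).
  move=> le; have [idl prl] := primesP l le.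
  exact: (prime_extension_prime primePe idl prl fsurj fker (subP l le)).
have memQ l a : (l <= e)%N -> (f a \in Q l) = (a \in P l).
  move=> le; have [idl prl] := primesP l le.
  exact: (mem_prime_extension_f idealPe idl prl fker (subP l le)).
have QP l : (l <= e)%N -> {subset Q l <= Q e}.
  move=> le y /asboolP [a [s [sP E /(subP l le) aP]]].
  by apply/asboolP; exists a, s.
have unitQ y : y \notin Q e -> exists t, y * t = 1.
  move=> yQ; have [a [s [sP E]]] := fsurj y.
  have aP : a \notin P e by apply: contra yQ => aP; apply/asboolP; exists a, s.
  have [t at1] := funit a aP; exists (f s * t).
  by rewrite mulrCA mulrA E.
have notall n (h x : 'I_n -> L) : \sum_i h i * x i = 1 -> exists i, x i \notin Q e.
  move=> hx; apply/existsP; apply: contraPT hx; rewrite negb_exists => /forallP xQ.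
  have [Q0 Q1 QD] := idealQ e (leqnn e) => hx1; case/negP: Q1; rewrite -hx1.
  elim/big_ind: _ => // [a b aQ bQ|i _]; first by rewrite -[a]mul1r QD.
  by rewrite -[_ * _]addr0 QD //; have := xQ i; rewrite negbK.
have [sB [n [fi [hi [hf1 freeB]]]]] := base_change_Ter f uTer.
have [i fiQ] := notall _ _ _ hf1.
have [J spanJ] := free_away_frame (idealQ e (leqnn e)) (primeQ e (leqnn e)) unitQ
  fiQ sB (freeB i).
have [x [xJ BE]] := Ter_frame (base_change_Ter f uTer) spanJ.
have := subalgebra1 sB; rewrite BE => x1.
have J_inj := framed_inj xJ.
have xN l := @framed_None _ _ c_gt0 g L J x xJ x1 l.
have J_None l := (xN l).1.
have xE := chart_mx_surj J_inj J_None xJ (fun l => (xN l).2).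
set pt := (fun d : chart_idx J => _) in xE.
pose N := #|{: chart_idx J}|.
have [ev evE] := mpoly_eval (fun i : 'I_N => pt (enum_val i)).
(* [T1] is the image of [ev], the k-subalgebra of [L] generated by the coordinates. *)
have [T1 [j1 [j1_inj j1E]]] : exists (T : comAlgType k) (j : {lrmorphism T -> L}),
    injective j /\ forall y, y \in (fun y => `[< exists F, y = ev F >] : bool)
      <-> exists x, y = j x.
  apply: exists_subalgebra; split.
  - by apply/asboolP; exists 1; rewrite rmorph1.
  - move=> a y z /asboolP [F ->] /asboolP [G ->]; apply/asboolP.
    by exists (a *: F + G); rewrite linearP.
  - move=> y z /asboolP [F ->] /asboolP [G ->]; apply/asboolP.
    by exists (F * G); rewrite rmorphM.
have /choice [pt1 pt1E] d : exists z, pt d = j1 z.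
  by apply/j1E/asboolP; exists 'X_(enum_rank d); rewrite evE enum_rankK.
pose x1' := chart_mx pt1.
have j1x : (fun y l => j1 (x1' y l)) = x.
  rewrite chart_mx_map xE; congr chart_mx; apply/funext => d; by rewrite pt1E.
pose u1 := ker_sub c_gt0 x1'.
have u1Ter : Ter g u1.
  split; last exact: (@ker_sub_locally_free _ _ c_gt0 g T1 J _ (chart_mx_framed J_inj _)).
  apply: (@ker_sub_subalgebra_inj T1 L j1 J) => //; first exact: chart_mx_framed.
    exact: chart_mx1.
  by rewrite j1x -BE.
have BC1 : Aplus_base_change j1 u1 = Aplus_base_change f u.
  rewrite (@base_change_ker _ _ c_gt0 g T1 J _ (chart_mx_framed J_inj _)) j1x.
  by rewrite BE.
(* The complement of V(E) is the part of Spec T1 that lands in Spec R. Spec L maps into it through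
   [f], so some element of [E] is a unit in the local ring [L]. *)
have [E EP] := uopen T1 u1 u1Ter.
have [n1 [e1 [h1 [e1E he1]]]] : generates_unit_ideal j1 E.
  by apply/EP; exists f; rewrite BC1.
have [i1 eQ] := notall _ _ _ he1.
pose eps := e1 i1; have [w ew] := unitQ _ eQ.
have epsE N' : j1 eps ^+ N' \notin Q e.
  elim: N' => [|n' /negPf IHn]; first by case: (idealQ e (leqnn e)).
  by apply/negP; rewrite exprS => /primeQ; rewrite IHn (negPf eQ) => /(_ (leqnn e)).
have [F0 F0E] : exists F, j1 eps = ev F.
  by apply/asboolP/j1E; exists eps.
(* [T2] is T1[1 / eps], realized inside [L]. *)
have [T2 [j2 [j2_inj j2E]]] : exists (T : comAlgType k) (j : {lrmorphism T -> L}),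
    injective j /\ forall y, y \in (fun y => `[< exists n F, j1 eps ^+ n * y = ev F >] : bool)
      <-> exists x, y = j x.
  apply: exists_subalgebra; split.
  - by apply/asboolP; exists 0%N, 1; rewrite mulr1 rmorph1.
  - move=> a y z /asboolP [p [F FE]] /asboolP [q [G GE]]; apply/asboolP.
    exists (p + q)%N, (a *: (F0 ^+ q * F) + F0 ^+ p * G).
    rewrite linearP /= !rmorphM !rmorphXn /= -F0E -FE -GE mulrDr -scalerAr exprD.
    by congr (_ *: _ + _); ring.
  - move=> y z /asboolP [p [F FE]] /asboolP [q [G GE]]; apply/asboolP.
    by exists (p + q)%N, (F * G); rewrite rmorphM /= -FE -GE exprD; ring.
have [j12 j12E] : exists j12 : {lrmorphism T1 -> T2}, forall y, j2 (j12 y) = j1 y.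
  apply: subalgebra_corestrict => // y; apply/j2E/asboolP; exists 0%N.
  have /j1E /asboolP [F FE] : exists z, j1 y = j1 z by exists y.
  by exists F; rewrite mul1r.
have [wt wtE] : exists wt, w = j2 wt.
  by apply/j2E/asboolP; exists 1%N, 1; rewrite expr1 ew rmorph1.
have [phi phiE] : exists phi : {lrmorphism R -> T2},
    Aplus_base_change phi u = Aplus_base_change j12 u1.
  apply/EP; exists 1%N, (fun _ => eps), (fun _ => wt); split=> [_|]; first exact: e1E.
  by rewrite big_ord1; apply: j2_inj; rewrite rmorphM /= j12E -wtE mulrC ew rmorph1.
have phif a : j2 (phi a) = f a.
  (* Both morphisms pull [u] back to the same point over [L], and [u] is a monomorphism; hence [f]
     takes its values in [T2]. *)
  apply: (umono L (j2 \o phi : {lrmorphism R -> L}) f).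
  rewrite -BC1 -(@base_change_comp _ _ c_gt0 _ _ _ phi j2) //.
  by rewrite phiE; apply: base_change_comp => y; exact: esym (j12E y).
(* The pulled-back chain stays strict: a power of the unit [j1 eps] carries the image of any element
   of R to a value of [ev]. *)
pose Qp l : {pred {mpoly k[N]}} := fun F => ev F \in Q l.
have QpE l F : (F \in Qp l) = (ev F \in Q l) by [].
rewrite -(card_chart_idx J_inj J_None); apply: (@mpoly_prime_chain k N e Qp); split=> l le.
  have [Q0 Q1 QD] := idealQ l le; split; first split.
  - by rewrite QpE rmorph0.
  - by rewrite QpE rmorph1.
  - by move=> F G H GQ HQ; rewrite QpE rmorphD rmorphM; apply: QD.
  by move=> F G; rewrite !QpE rmorphM; apply: primeQ.
have [subl [y yl' yl]] := stepsP l le; split.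
  by move=> F /asboolP [a [s [sP E' /subl aP]]]; apply/asboolP; exists a, s.
have [p [F FE]] : exists p F, j1 eps ^+ p * f y = ev F.
  by apply/asboolP/j2E; exists (phi y); rewrite phif.
exists F.
  have [Q0 _ QD] := idealQ l.+1 le.
  by rewrite QpE -FE -[_ * _]addr0 QD // memQ.
rewrite QpE -FE; apply/negP => /(primeQ l (ltnW le)).
rewrite memQ ?(negPf yl) ?orbF; last exact: ltnW.
by move=> /(QP l (ltnW le)); apply/negP/epsE.
Qed.
End UpperBound.

(** * The lower bound *)

Section MonomialProducts.
Variables (m : nat) (c : 'I_m -> nat) (c_gt0 : forall i, (0 < c i)%N).
Local Notation A R := (Aplus c_gt0 R).
Local Notation bidx := (bidx c).
Local Notation bvec R := (bvec c_gt0 R).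

Lemma bvecM (R : comNzRingType) (y z : bidx) :
  bvec R y * bvec R z = 0 \/
  exists w : bidx, bvec R y * bvec R z = bvec R w /\ bmon w = (bmon y + bmon z)%MM.
Proof.
have yzE : bvec R y * bvec R z = \pi_(A R) ('X_[bmon y + bmon z] : {mpoly R[m]}).
  by rewrite mpolyXD rmorphM.
have [/existsP [w /eqP wE]|] := boolP [exists w : bidx, bmon w == (bmon y + bmon z)%MM].
  by right; exists w; rewrite yzE -wE.
rewrite negb_exists => /forallP yz; left; rewrite yzE -(rmorph0 (\pi_(A R))).
apply/eqP; rewrite -Quotient.idealrBE subr0; apply: Aplus_idealX => w.
by rewrite eq_sym.
Qed.

(* The t_i ^ j with 2 j >= c_i, in the indexing of [bidx]. *)
Definition upper_half : {set bidx} :=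
  [set y : bidx | if y is Some z then (c (tag z) <= (tagged z : 'I__).+1.*2)%N else false].

Lemma upper_halfM (R : comNzRingType) (y z : bidx) :
  y \in upper_half -> z \in upper_half -> bvec R y * bvec R z = 0.
Proof.
rewrite !inE; case: (bvecM R y z) => // -[w [_]].
case: y z => [[i j]|] // [[i' j']|] //= wE ci ci'; exfalso.
have wi := congr1 (fun u : 'X_{1..m} => u i) wE.
have wi' := congr1 (fun u : 'X_{1..m} => u i') wE.
rewrite /= !(mnmDE, mulmnE, mnm1E) in wi wi'.
have [ii'|ii'] := eqVneq i i'; last first.
  have := bmon_one w ii'; rewrite wi wi' !eqxx !mul1n.
  by rewrite !addn_eq0 /= andbF.
subst i'; move: wi; rewrite eqxx !mul1n => wi.
have := bmon_lt c_gt0 w i; rewrite wi ltnNge -leq_double doubleD.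
by rewrite -addnn leq_add.
Qed.

Lemma card_leq_ord (n a : nat) : (\sum_(j < n) (a <= j) = n - a)%N.
Proof.
elim: n => [|n IHn]; first by rewrite big_ord0.
rewrite big_ord_recr /= IHn; case: leqP => an; first by rewrite subSn // addn1.
have := an; rewrite -subn_eq0 => /eqP ->.
by have := ltnW an; rewrite -subn_eq0 => /eqP ->.
Qed.

(** Each i contributes the floor of c_i / 2, so doubling falls short of c_i by one exactly when c_i
    is odd. *)
Lemma card_upper_half :
  ((#|upper_half|).*2 + #|[set i | odd (c i)]| = \sum_i c i)%N.
Proof.
pose up (z : {i : 'I_m & 'I_(c i).-1}) := (c (tag z) <= (tagged z : 'I__).+1.*2)%N.
have -> : #|upper_half| = (\sum_i (c i)./2)%N.
  have -> : upper_half = Some @: [set z | up z].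
    apply/setP => -[z|]; rewrite !inE ?(mem_imset _ _ (@Some_inj _)) ?inE //.
    by apply/esym/negP => /imsetP [].
  rewrite card_imset; last exact: Some_inj.
  rewrite -sum1_card big_mkcond /=.
  rewrite (eq_bigr (fun z => nat_of_bool (up z))) => [|z _]; last by rewrite inE; case: up.
  rewrite -(sig_big_dep xpredT (fun _ => xpredT)
    (fun i (j : 'I_(c i).-1) => nat_of_bool (c i <= j.+1.*2)%N)) /=.
  (* The index [j] stands for the exponent j + 1, hence the predecessor of [uphalf (c i)]. *)
  apply: eq_bigr => i _; rewrite (eq_bigr (fun j : 'I__ => nat_of_bool
    ((uphalf (c i)).-1 <= j)%N)) => [|j _].
    have cE : (c i = uphalf (c i) + (c i)./2)%N.
      by rewrite uphalf_half -addnA addnn odd_double_half.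
    have u_gt0 : (0 < uphalf (c i))%N by rewrite uphalf_gt0.
    by rewrite card_leq_ord {1}cE -{1}(prednK u_gt0) addSn /= addKn.
  by rewrite -leq_uphalf_double -ltnS; case: (uphalf _).
rewrite -mul2n big_distrr /= -sum1_card [X in (_ + X)%N]big_mkcond -big_split /=.
apply: eq_bigr => i _; rewrite inE mul2n -[RHS]odd_double_half addnC.
by case: odd.
Qed.
End MonomialProducts.

Section ChartChain.
Variables (m : nat) (c : 'I_m -> nat) (c_gt0 : forall i, (0 < c i)%N) (g : nat).
Variable k : fieldType.
Variable J : 'I_g -> bidx c.
Hypotheses (J_inj : injective J) (J_None : forall i, J i != None).

(* Killing the active coordinates one at a time gives a chain of kernels. *)
Lemma chart_prime_chain (Act : {set chart_idx J}) :
  (forall (T : comAlgType k) (pt : chart_idx J -> T),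
     (forall d, d \notin Act -> pt d = 0) -> chart_point c_gt0 pt) ->
  exists (R : comAlgType k) (u : pred (Aplus c_gt0 R)) (P : nat -> {pred R}),
    @affine_open k (Ter_over c_gt0 g k) R u /\ prime_chain #|Act| P.
Proof.
move=> ActP; pose N := #|{: chart_idx J}|; pose T := {mpoly k[N]}.
(* The first [l] active coordinates are 0 and the later ones are independent variables. *)
pose pt l (d : chart_idx J) : T :=
  if (d \in Act) && (l <= index d (enum Act))%N then 'X_(enum_rank d) else 0.
have ptP l : chart_point c_gt0 (pt l).
  by apply: (ActP {mpoly k[N]}) => d /negPf dA; rewrite /pt dA.
have [S [ptS [ptSP ptSU ptSI]]] := exists_chart J_inj J_None (ptP 0%N).
have /choice [f fE] l : exists f : {lrmorphism S -> T}, forall d, f (ptS d) = pt l d.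
  exact: (ptSU {mpoly k[N]} (pt l) (ptP l)).
pose P l : {pred S} := fun x => f l x == 0.
have PE l x : (x \in P l) = (f l x == 0) by [].
exists S, (ker_sub c_gt0 (chart_mx ptS)), P.
split; first exact: chart_affine_open.
split=> l le.
  split; first split.
  - by rewrite PE rmorph0.
  - by rewrite PE rmorph1 oner_eq0.
  - by move=> a x y; rewrite !PE rmorphD rmorphM /= => /eqP -> /eqP ->; rewrite mulr0 addr0.
  - by move=> x y; rewrite !PE rmorphM mulf_eq0.
have [d0 _] : exists d, d \in Act by apply/card_gt0P; apply: leq_trans le.
have szA : size (enum Act) = #|Act| by rewrite cardE.
pose d := nth d0 (enum Act) l.
have dA : d \in Act by rewrite -mem_enum mem_nth ?szA.
have dl : index d (enum Act) = l by rewrite index_uniq ?enum_uniq ?szA.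
split.
  (* The substitution that kills the variable of [d] carries [pt l] to [pt l.+1], so the kernels
     increase. *)
  have [h hE] := mpoly_eval (fun i : 'I_N =>
    if enum_val i == d then 0 else 'X_i : {mpoly k[N]}).
  have hf := ptSI T (h \o f l : {lrmorphism S -> T}) (f l.+1).
  move=> x; rewrite !PE => /eqP x0; rewrite -hf /= ?x0 ?rmorph0 // => d'.
  rewrite /= !fE /pt; case: (boolP (d' \in Act)) => d'A /=; last by rewrite rmorph0.
  rewrite [(l <= _)%N]leq_eqVlt; case: ltnP => ld' /=.
    rewrite orbT hE enum_rankK; case: eqP => // d'E.
    by rewrite d'E dl ltnn in ld'.
  rewrite orbF; case: eqP => [lE|_]; last by rewrite rmorph0.
  rewrite hE enum_rankK ifT // /d lE nth_index // mem_enum //.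
exists (ptS d); rewrite !PE fE /pt dA dl ?ltnn ?leqnn //=.
by rewrite -msize_poly_eq0 msizeX.
Qed.
End ChartChain.

(** * Explicit points of the territory *)

Section Points.
Variables (m : nat) (c : 'I_m -> nat) (c_gt0 : forall i, (0 < c i)%N) (g : nat).
Local Notation bidx := (bidx c).
Local Notation bvec R := (bvec c_gt0 R).

Lemma exists_frame_row (D : {set bidx}) :
  None \notin D -> (#|D| + g)%N = #|{: bidx}|.-1 ->
  exists J : 'I_g -> bidx,
    [/\ injective J, forall i, J i != None & chart_row J = D].
Proof.
move=> DN cardD; pose E := ~: (None |: D).
have cardE : g = #|E|.
  rewrite cardsCs setCK cardsU1 DN; apply/eqP; rewrite -(eqn_add2l #|D|) cardD.
  rewrite addnC subnDA subn1 subnK // -cardD leq_addr //.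
pose J i := enum_val (cast_ord cardE i).
have codomJ y : (y \in codom J) = (y \in E).
  apply/codomP/idP => [[i ->]|yE]; first exact: enum_valP.
  exists (cast_ord (esym cardE) (enum_rank_in yE y)).
  by rewrite /J cast_ordKV enum_rankK_in.
exists J; split.
- by move=> i j /enum_val_inj /cast_ord_inj.
- move=> i; have : J i \in E by rewrite -codomJ codom_f.
  by rewrite !inE negb_or => /andP [].
apply/setP => y; rewrite inE codomJ !inE negbK.
by have [->|] := eqVneq y None; rewrite ?(negPf DN).
Qed.

Variable J : 'I_g -> bidx.
Hypotheses (J_inj : injective J) (J_None : forall i, J i != None).

Section Point.
Variables (R : comNzRingType) (pt : chart_idx J -> R).
Local Notation x := (chart_mx pt).
Local Notation rel := (rel_vec c_gt0 J x).

(** Since [rel] is 1 at [None] and 0 on t_J, only products of the remaining rows impose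
    conditions. *)
Lemma chart_pointI :
  (forall y z, y \in chart_row J -> z \in chart_row J ->
     forall l, mxform x l (rel y * rel z) = 0) -> chart_point c_gt0 pt.
Proof.
move=> relM; have xJ := chart_mx_framed J_inj pt.
have mxform_rel y l : mxform x l (rel y) = 0 by move: l; apply/ker_subP/rel_vec_ker.
have relN : rel None = 1.
  rewrite /rel_vec bvec_None big1 ?subr0 // => i _.
  by rewrite chart_mx_None ?rmorph0 ?mul0r.
have relJ i : rel (J i) = 0.
  rewrite /rel_vec (bigD1 i) //= xJ eqxx rmorph1 mul1r big1 ?addr0 ?subrr //.
  by move=> l /negPf li; rewrite xJ eq_sym li rmorph0 mul0r.
have cases y : [\/ y = None, exists i, y = J i | y \in chart_row J].
  have [->|yN] := eqVneq y None; first by constructor 1.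
  have [/codomP|yJ] := boolP (y \in codom J); first by constructor 2.
  by constructor 3; rewrite inE yN.
apply: (@ker_sub_subalgebra _ _ c_gt0 g R J); first exact: chart_mx1.
move=> y z l; case: (cases y) => [->|[i ->]|yD].
- by rewrite relN mul1r.
- by rewrite relJ mul0r mxform0.
case: (cases z) => [->|[i ->]|zD]; last exact: relM.
- by rewrite relN mulr1.
- by rewrite relJ mulr0 mxform0.
Qed.

(** Under these hypotheses the vectors [rel] of [chart_row J] lie in the span of [upper_half], where
    all products vanish. *)
Lemma chart_point_upper_half : chart_row J \subset upper_half c ->
  (forall d, J d.2 \notin upper_half c -> pt d = 0) -> chart_point c_gt0 pt.
Proof.
move=> /subsetP rowW pt0; apply: chart_pointI => y z yD zD l.
have annih a y' : y' \in chart_row J ->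
    (forall w, w \in upper_half c -> a * bvec R w = 0) -> a * rel y' = 0.
  move=> y'D aW; rewrite mulrBr aW ?rowW // mulr_sumr big1 ?subr0 // => i _.
  rewrite mulrCA; have [/aW ->|Ji] := boolP (J i \in upper_half c).
    by rewrite mulr0.
  by rewrite (chart_mx_row pt (exist _ y' y'D, i)) pt0 // rmorph0 mul0r.
rewrite (annih _ _ zD) ?mxform0 // => w wW; rewrite mulrC.
by apply: annih => // v vW; apply: upper_halfM.
Qed.

(** The kernel is spanned by 1 and the monomials of [chart_row J], which span an ideal because they
    are closed under multiples. *)
Lemma chart_point0 :
  (forall y w, y \in chart_row J -> (bmon y <= bmon w)%MM -> w \in chart_row J) ->
  (forall d, pt d = 0) -> chart_point c_gt0 pt.
Proof.
move=> Dup pt0; have x0 y : y \in chart_row J -> forall l, x y l = 0.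
  by move=> yD l; rewrite (chart_mx_row pt (exist _ y yD, l)) pt0.
have relD y : y \in chart_row J -> rel y = bvec R y.
  move=> yD; rewrite /rel_vec big1 ?subr0 // => i _.
  by rewrite x0 // rmorph0 mul0r.
apply: chart_pointI => y z yD zD l; rewrite !relD //.
case: (bvecM c_gt0 R y z) => [->|[w [-> wE]]]; first by rewrite mxform0.
rewrite mxform_bvec x0 // (Dup y) // wE lem_addr //.
Qed.
End Point.

End Points.

(** Each step adds a monomial of maximal degree among those left; its proper multiples have larger
    degree, so they are already in the set. *)
Lemma exists_upper_set (m : nat) (c : 'I_m -> nat) (r : nat) :
  (r <= #|{: bidx c}|.-1)%N ->
  exists D : {set bidx c}, [/\ None \notin D, #|D| = r
    & forall y w, y \in D -> (bmon y <= bmon w)%MM -> w \in D].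
Proof.
elim: r => [|r IHr] rn.
  by exists set0; split=> [||y w]; rewrite ?cards0 ?in_set0.
have [D [DN cD Dup]] := IHr (ltnW rn).
have [y0 y0D] : exists y, y \in ~: (None |: D).
  apply/card_gt0P; rewrite cardsCs setCK cardsU1 DN cD subn_gt0 add1n.
  by rewrite -ltn_predRL.
case: (arg_maxnP (fun y => mdeg (bmon y)) y0D) => y yE ymax.
have : y \in ~: (None |: D) by []; rewrite !inE negb_or => /andP [yN yD].
exists (y |: D); split.
- by rewrite !inE negb_or DN eq_sym yN.
- by rewrite cardsU1 yD cD.
move=> z w; rewrite !inE => /orP [/eqP -> {z}|zD] zw; last by rewrite (Dup z) ?orbT.
have [//|wD /=] := boolP (w \in D); first by rewrite orbT.
rewrite orbF; apply/eqP/bmon_inj; have wE := submK zw.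
have dw : (mdeg (bmon w) = mdeg (bmon w - bmon y)%MM + mdeg (bmon y))%N.
  by rewrite -mdegD wE.
have wN : w != None.
  apply: contraNneq yN => wN; apply/eqP/bmon_inj/mnmP => i.
  by have /mnm_lepP/(_ i) := zw; rewrite wN /= mnm0E leqn0 => /eqP ->.
have /ymax : w \in ~: (None |: D) by rewrite !inE negb_or wN.
rewrite /= dw -[X in (_ <= X)%N]add0n leq_add2r leqn0 mdeg_eq0 => /eqP w0.
by rewrite -wE w0 add0m.
Qed.

Theorem theorem1p4 (m : nat) (c : 'I_m -> nat)
    (c_gt0 : forall i : 'I_m, (0 < c i)%N) (g : nat) :
  let C : rat := (\sum_(i < m) c i)%N%:R in
  let p : rat := #|[set i : 'I_m | odd (c i)]|%:R in
  Ter_nonempty c_gt0 g ->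
  forall k : closedFieldType,
  exists2 d : nat, has_dim (Ter_over c_gt0 g k) d &
    (C - m%:R - g%:R) * (g%:R + m%:R - C / 2%:R - p / 2%:R) <= d%:R
    /\ d%:R <= (C - m%:R - g%:R) * g%:R.
Proof.
(* Nonemptiness over some ring enters as the inequality g <= c - m, from which points over k are
   constructed. *)
move=> C p [R0 [B0 /Ter_rank_le gn]] k.
pose n := #|{: bidx c}|.-1; pose r := (n - g)%N; pose w := #|upper_half c|.
have mC : (m <= \sum_i c i)%N.
  by rewrite -[X in (X <= _)%N]card_ord -sum1_card leq_sum.
have nE : n = (\sum_i c i - m)%N by rewrite /n card_bidx.
have {}gn : (g <= n)%N by rewrite /n -ltnS prednK // card_bidx.
have rE : C - m%:R - g%:R = r%:R by rewrite /r natrB // nE natrB.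
(* By [card_upper_half], C = 2 w + p. *)
have wE : g%:R + m%:R - C / 2%:R - p / 2%:R = w%:R - r%:R.
  rewrite -rE /C -(card_upper_half c_gt0) -/w natrD -mul2n natrM -/p.
  by field.
rewrite rE wE.
pose chain e := exists (R : comAlgType k) (u : pred (Aplus c_gt0 R)) (P : nat -> {pred R}),
  @affine_open k (Ter_over c_gt0 g k) R u /\ prime_chain e P.
have chain_le e : chain e -> (e <= r * g)%N.
  by move=> [R [u [P [uO PC]]]]; apply: affine_open_chain_le uO PC.
(* The difference is truncated: for w < r a chain of length 0 is enough. *)
have [e0 e0C e0w] : exists2 e, chain e & (r * (w - r) <= e)%N.
  have [rw|wr] := leqP r w.
    have [D /subsetP DW cD] : exists2 D : {set bidx c}, D \subset upper_half c & #|D| = r.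
      exists [set x in take r (enum (upper_half c))].
        by apply/subsetP => x; rewrite inE => /mem_take; rewrite mem_enum.
      rewrite cardsE; have /card_uniqP -> := take_uniq r (enum_uniq (upper_half c)).
      by rewrite size_takel // -cardE.
    have [||J [J_inj J_None JD]] := @exists_frame_row m c g D.
    - by apply/negP => /DW; rewrite inE.
    - by rewrite cD subnK.
    pose Act := [set d : chart_idx J | J d.2 \in upper_half c].
    exists #|Act|.
      apply: chart_prime_chain => // T pt pt0.
      apply: chart_point_upper_half => //; first by rewrite JD; apply/subsetP.
      by move=> d dW; apply: pt0; rewrite inE.
    (* Active coordinates pair one of the r monomials of D with a frame monomial in the upper half;
       the w - r monomials of the upper half outside D are all frame monomials. *)
    have -> : Act = setX [set: {y | y \in chart_row J}] [set i | J i \in upper_half c].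
      by apply/setP => d; rewrite !inE.
    rewrite cardsX cardsT card_sig -cD -JD (eq_card (fun y => erefl (y \in chart_row J))).
    rewrite leq_mul2l JD -cardsDS; last exact/subsetP.
    apply/orP; right; rewrite -(card_imset _ J_inj) subset_leq_card //.
    apply/subsetP => y; rewrite in_setD -JD [_ \in chart_row J]inE negb_and !negbK.
    move=> /andP [/orP [/eqP ->|/codomP [i ->]] yW]; first by rewrite inE in yW.
    by apply: imset_f; rewrite inE.
  have [D [DN cD Dup]] := @exists_upper_set m c r (leq_subr _ _).
  have [|J [J_inj J_None JD]] := exists_frame_row DN (g := g).
    by rewrite cD subnK.
  (* Without active coordinates, the chain is the single kernel at the point with all coordinates
     0. *)
  exists #|(set0 : {set chart_idx J})|.
    apply: chart_prime_chain => // T pt pt0.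
    apply: chart_point0 => // [|d]; first by rewrite JD.
    by apply: pt0; rewrite inE.
  by have := ltnW wr; rewrite -subn_eq0 => /eqP ->; rewrite muln0.
have exC : exists e, `[< chain e >] by exists e0; apply/asboolP.
have ubC e : `[< chain e >] -> (e <= r * g)%N by move/asboolP; apply: chain_le.
(* Lengths of chains are bounded by r g, so the supremum that defines the dimension is attained. *)
case: (ex_maxnP exC ubC) => d /asboolP dC dmax; exists d.
  by split=> // R u e P uO PC; apply: dmax; apply/asboolP; exists R, u, P.
split; last by rewrite -natrM ler_nat chain_le.
have [rw|wr] := leqP r w.
  rewrite -natrB // -natrM ler_nat (leq_trans e0w) // dmax //.
  exact/asboolP.
by rewrite (le_trans (mulr_ge0_le0 _ _)) // ?subr_le0 ?ler_nat // ltnW.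
Qed.
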